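(* Let $e_1<e_2<e_3<e_4$ be distinct reals and $h>0$. For $\mathbf L\in M_h$ let $(\eta_1,\eta_2)=(\eta_1(\mathbf L),\eta_2(\mathbf L))$, let $r_1\le r_2$ be the roots of $R(z)=2hz^2-\eta_1z+\eta_2$, let $A(z)=\prod_{k=1}^4(z-e_k)$, $p(s)=\sqrt{-R(s)/(4A(s))}$, and define the action map $\mathbf L\mapsto(J_1,J_2,J_3)$ by $$J_1=\frac2\pi\int_{e_1}^{\min(r_1,e_2)}p\,ds,\quad J_2=\frac2\pi\int_{\max(r_1,e_2)}^{\min(r_2,e_3)}p\,ds,\quad J_3=\frac2\pi\int_{\max(r_2,e_3)}^{e_4}p\,ds.$$ Then the image of $M_h$ under this action map is the equilateral triangle $\mathcal T=\{(J_1,J_2,J_3)\in\mathbb R^3: J_1,J_2,J_3\ge0,\ J_1+J_2+J_3=\sqrt{2h}\}$.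
   Context: $M_h=\{\mathbf L=(\ell_{12},\ell_{13},\ell_{14},\ell_{23},\ell_{24},\ell_{34})\in\mathbb R^6:\sum_{i<j}\ell_{ij}^2=2h,\ \ell_{12}\ell_{34}-\ell_{13}\ell_{24}+\ell_{14}\ell_{23}=0\}\cong S^2\times S^2$ (a symplectic leaf of $\mathfrak{so}(4)^*$), and $\eta_1=\sum_{i<j}\ell_{ij}^2\sum_{k\ne i,j}e_k$, $\eta_2=\sum_{i<j}\ell_{ij}^2\prod_{k\ne i,j}e_k$. For $\mathbf L\in M_h$ the roots $r_1\le r_2$ are real and lie in $[e_1,e_4]$. *)

(* Defs.v *)
From HB Require Import structures.
From mathcomp Require Import all_boot all_order all_algebra.
From mathcomp Require Import all_classical all_reals all_analysis.
Set Implicit Arguments. Unset Strict Implicit. Unset Printing Implicit Defensive.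
Import Order.TTheory GRing.Theory Num.Theory.
Import numFieldNormedType.Exports.
Local Open Scope classical_set_scope.
Local Open Scope ring_scope.

(* A point L = (l12,l13,l14,l23,l24,l34) of so(4)^* ~ R^6. *)
Record so4 (R : Type) := mkL {
  l12 : R; l13 : R; l14 : R; l23 : R; l24 : R; l34 : R }.

Section Defs.
Variable R : realType.

Definition M_h (h : R) : set (so4 R) :=
  [set L | l12 L ^+ 2 + l13 L ^+ 2 + l14 L ^+ 2 + l23 L ^+ 2 + l24 L ^+ 2
             + l34 L ^+ 2 = 2 * h
         /\ l12 L * l34 L - l13 L * l24 L + l14 L * l23 L = 0].

Definition eta1 (e1 e2 e3 e4 : R) (L : so4 R) : R :=
  l12 L ^+ 2 * (e3 + e4) + l13 L ^+ 2 * (e2 + e4) + l14 L ^+ 2 * (e2 + e3)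
  + l23 L ^+ 2 * (e1 + e4) + l24 L ^+ 2 * (e1 + e3) + l34 L ^+ 2 * (e1 + e2).

Definition eta2 (e1 e2 e3 e4 : R) (L : so4 R) : R :=
  l12 L ^+ 2 * (e3 * e4) + l13 L ^+ 2 * (e2 * e4) + l14 L ^+ 2 * (e2 * e3)
  + l23 L ^+ 2 * (e1 * e4) + l24 L ^+ 2 * (e1 * e3) + l34 L ^+ 2 * (e1 * e2).

Definition Rpol (h et1 et2 z : R) : R := 2 * h * z ^+ 2 - et1 * z + et2.

(* the roots r1 <= r2 of R (real for L in M_h), via the quadratic formula *)
Definition root1 (h et1 et2 : R) : R :=
  (et1 - Num.sqrt (et1 ^+ 2 - 8 * h * et2)) / (4 * h).
Definition root2 (h et1 et2 : R) : R :=
  (et1 + Num.sqrt (et1 ^+ 2 - 8 * h * et2)) / (4 * h).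

Definition Apol (e1 e2 e3 e4 z : R) : R :=
  (z - e1) * (z - e2) * (z - e3) * (z - e4).

Definition pfun (e1 e2 e3 e4 h et1 et2 s : R) : R :=
  Num.sqrt (- Rpol h et1 et2 s / (4 * Apol e1 e2 e3 e4 s)).

(* (2/pi) * int_a^b p ds, Lebesgue integral over [a,b] (improper at the e_k) *)
Definition act (p : R -> R) (a b : R) : R :=
  2 / pi * Rintegral lebesgue_measure `[a, b] p.

Definition action_map (e1 e2 e3 e4 h : R) (L : so4 R) : R * R * R :=
  let et1 := eta1 e1 e2 e3 e4 L in
  let et2 := eta2 e1 e2 e3 e4 L in
  let r1 := root1 h et1 et2 in
  let r2 := root2 h et1 et2 in
  let p := pfun e1 e2 e3 e4 h et1 et2 in
  (act p e1 (Num.min r1 e2),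
   act p (Num.max r1 e2) (Num.min r2 e3),
   act p (Num.max r2 e3) e4).

Definition triangle (h : R) : set (R * R * R) :=
  [set J | 0 <= J.1.1 /\ 0 <= J.1.2 /\ 0 <= J.2
         /\ J.1.1 + J.1.2 + J.2 = Num.sqrt (2 * h)].

End Defs.

(* Main.v *)
Require Import Defs.
From HB Require Import structures.
From mathcomp Require Import all_boot all_order all_algebra.
From mathcomp Require Import all_classical all_reals all_analysis.
From mathcomp Require Import measurable_realfun.
From mathcomp Require Import ring lra.
Set Implicit Arguments. Unset Strict Implicit. Unset Printing Implicit Defensive.
Import Order.TTheory GRing.Theory Num.Theory.
Import numFieldNormedType.Exports.
Local Open Scope classical_set_scope.
Local Open Scope ring_scope.

(* Write L = x /\ y. Up to the factor 2h, R is the characteristic polynomial of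
   diag(e1,..,e4) compressed to the plane orthogonal to x and y; hence the pairs
   of roots are exactly those with e1 <= r1 <= e3, e2 <= r2 <= e4, r1 <= r2.
   That J1 + J2 + J3 is constant is obtained without complex analysis: with
   P1 = (z - r2)(z - e1)(z - e3) and P0 = (z - r1)(z - e2)(z - e4), the roots of
   t P1 + (1 - t) P0, 0 <= t <= 1, sweep the three intervals of integration, and
   by Lagrange interpolation the three integrands pulled back to t add up to
   dt / sqrt(t (1 - t)). Surjectivity onto the triangle follows because J1 is
   increasing and J3 decreasing in both roots, so an extremal pair of roots with
   J1 >= j1 and J3 >= j3 attains both values. *)

(** Two features of the actions obstruct a direct treatment: the limits of integration move with the
    roots and change form when [r1] crosses [e2] or [r2] crosses [e3], and the integrand blows up at
    the nodes. Clipping removes both: [Num.sqrt] is 0 on negative reals, so each action is a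
    multiple of an integral [wint] over a fixed gap between consecutive nodes, where the roots enter
    only through a bounded factor against the fixed integrable weight 1 / sqrt |A|. Monotonicity and
    continuity in the roots become statements about integrands, and continuity carries the sum
    identity from six distinct endpoints to all configurations. The pencil is chosen because P0 P1 =
    N A with N = (z - r1)(z - r2), so that p is proportional to |N| / sqrt(- P0 P1), and because
    every interval of integration joins a root of P0 to a root of P1. Only the leading coefficient
    of N survives the interpolation, which is why the total does not depend on the roots.
    Surjectivity onto a two-dimensional set rests on order and on continuity in one variable at a
    time, in place of a degree argument. *)

Definition root_domain {R : realType} (e1 e2 e3 e4 r1 r2 : R) :=
  [/\ e1 <= r1, r1 <= e3, e2 <= r2, r2 <= e4 & r1 <= r2].

(** * Which pairs of roots occur on the leaf *)

Section roots.
Context {R : realType}.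
Implicit Types (e h r et z m : R) (L : so4 R).

(* L spans the orthogonal complement of the plane generated by two unit vectors
   supported on the coordinates (1,3) and (2,4), with Rayleigh quotients r1 and
   r2 for diag(e1,..,e4). *)
Lemma exists_so4_of_roots e1 e2 e3 e4 h r1 r2 :
  e1 < e2 -> e2 < e3 -> e3 < e4 -> 0 < h ->
  root_domain e1 e2 e3 e4 r1 r2 ->
  exists L, [/\ M_h h L, eta1 e1 e2 e3 e4 L = 2 * h * (r1 + r2)
    & eta2 e1 e2 e3 e4 L = 2 * h * (r1 * r2)].
Proof.
move=> e12 e23 e34 h0 [a1 a2 a3 a4 a5].
have d31 : 0 < e3 - e1 by lra.
have d42 : 0 < e4 - e2 by lra.
have nd31 : e3 - e1 != 0 by rewrite gt_eqF.
have nd42 : e4 - e2 != 0 by rewrite gt_eqF.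
(* The unit vectors are [(a,0,b,0)] and [(0,c,0,d)], their squared entries being the barycentric
   coordinates of [r1] in [[e1,e3]] and of [r2] in [[e2,e4]]. The witness is [s] times the wedge of
   [(b,0,-a,0)] and [(0,d,0,-c)], which span the complement. *)
pose a := Num.sqrt ((e3 - r1) / (e3 - e1)).
pose b := Num.sqrt ((r1 - e1) / (e3 - e1)).
pose c := Num.sqrt ((e4 - r2) / (e4 - e2)).
pose d := Num.sqrt ((r2 - e2) / (e4 - e2)).
pose s := Num.sqrt (2 * h).
have aE : a ^+ 2 = (e3 - r1) / (e3 - e1) by rewrite sqr_sqrtr// divr_ge0//; lra.
have bE : b ^+ 2 = (r1 - e1) / (e3 - e1) by rewrite sqr_sqrtr// divr_ge0//; lra.
have cE : c ^+ 2 = (e4 - r2) / (e4 - e2) by rewrite sqr_sqrtr// divr_ge0//; lra.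
have dE : d ^+ 2 = (r2 - e2) / (e4 - e2) by rewrite sqr_sqrtr// divr_ge0//; lra.
have sE : s ^+ 2 = 2 * h by rewrite sqr_sqrtr//; lra.
exists (mkL (s * b * d) 0 (- (s * b * c)) (s * a * d) 0 (s * a * c)).
rewrite /M_h /eta1 /eta2 /= !sqrrN !exprMn aE bE cE dE sE; split; [split| |].
- by field; apply/andP.
- by ring.
- by field; apply/andP.
- by field; apply/andP.
Qed.

(* [m / n] is the Rayleigh quotient of diag(e1,..,e4) at the vector
   (0, l34, -l24, l23), which is orthogonal to the plane of L, so it lies
   between the two roots. *)
Lemma Rpol_rayleigh_le0 e1 e2 e3 e4 h L : M_h h L ->
  let n := l34 L ^+ 2 + l24 L ^+ 2 + l23 L ^+ 2 in
  let m := e2 * l34 L ^+ 2 + e3 * l24 L ^+ 2 + e4 * l23 L ^+ 2 in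
  n != 0 -> Rpol h (eta1 e1 e2 e3 e4 L) (eta2 e1 e2 e3 e4 L) (m / n) <= 0.
Proof.
case: L => a b c d e f [/= LE LP] n0.
rewrite /Rpol -LE /eta1 /eta2 /=.
set n := f ^+ 2 + e ^+ 2 + d ^+ 2 in n0 *.
set m := e2 * f ^+ 2 + e3 * e ^+ 2 + e4 * d ^+ 2.
set S := a ^+ 2 + _ + _ + _ + _ + _.
set et1 := a ^+ 2 * (e3 + e4) + _ + _ + _ + _ + _.
set et2 := a ^+ 2 * (e3 * e4) + _ + _ + _ + _ + _.
(* With [v = (0,f,-e,d)] and [w] its image under the skew matrix dual to L, [v] and [w] are
   orthogonal vectors of the complementary plane and [X] is the inner product of diag(e1,..,e4) v
   with [w]. A symmetric 2x2 matrix has at a diagonal entry the characteristic value minus the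
   square of the off-diagonal entry, whence [- X ^+ 2]; [K] is the cofactor of the Pluecker
   relation. *)
pose X := e2 * f * (- (c * e) - b * d) - e3 * e * (a * d - c * f)
   + e4 * d * (b * f + a * e).
pose K := e2 ^+ 2 * f ^+ 2 * (a * f + b * e - c * d)
  - e3 ^+ 2 * e ^+ 2 * (a * f + b * e + c * d)
  + e4 ^+ 2 * d ^+ 2 * (- (a * f) + b * e + c * d)
  + e3 * e4 * (a * f * n + b * e * (- d ^+ 2 + e ^+ 2 + f ^+ 2)
       + c * d * (- d ^+ 2 + e ^+ 2 - f ^+ 2))
  + e2 * e4 * (a * f * (d ^+ 2 - e ^+ 2 - f ^+ 2) - b * e * n
       + c * d * (- d ^+ 2 - e ^+ 2 + f ^+ 2))
  + e2 * e3 * (a * f * (- d ^+ 2 + e ^+ 2 - f ^+ 2)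
       + b * e * (d ^+ 2 + e ^+ 2 - f ^+ 2) + c * d * n).
have id : S * m ^+ 2 - et1 * m * n + et2 * n ^+ 2 =
    (a * f - b * e + c * d) * K - X ^+ 2.
  by rewrite /S /et1 /et2 /m /K /X /n; ring.
have -> : S * (m / n) ^+ 2 - et1 * (m / n) + et2 =
    (S * m ^+ 2 - et1 * m * n + et2 * n ^+ 2) / n ^+ 2 by field.
by rewrite id LP mul0r sub0r mulNr oppr_le0 divr_ge0 ?sqr_ge0.
Qed.

Lemma Rpol_factor h et1 et2 z : 0 < h -> 0 <= et1 ^+ 2 - 8 * h * et2 ->
  Rpol h et1 et2 z = 2 * h * ((z - Defs.root1 h et1 et2) * (z - root2 h et1 et2)).
Proof.
move=> h0 D0; rewrite /Rpol /root1 /root2.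
have : Num.sqrt (et1 ^+ 2 - 8 * h * et2) ^+ 2 = et1 ^+ 2 - 8 * h * et2.
  by rewrite sqr_sqrtr.
set q := Num.sqrt _ => qE.
have -> : 2 * h * ((z - (et1 - q) / (4 * h)) * (z - (et1 + q) / (4 * h))) =
  2 * h * z ^+ 2 - et1 * z + (et1 ^+ 2 - q ^+ 2) / (8 * h).
  by field; rewrite gt_eqF.
by rewrite qE; field; rewrite gt_eqF.
Qed.

Lemma root1_le_root2 h et1 et2 : 0 < h -> Defs.root1 h et1 et2 <= root2 h et1 et2.
Proof.
move=> h0; rewrite /root1 /root2 ler_pM2r ?invr_gt0 ?mulr_gt0//.
by have := sqrtr_ge0 (et1 ^+ 2 - 8 * h * et2); lra.
Qed.

Lemma Rpol_le0_bounds h et1 et2 m : 0 < h -> Rpol h et1 et2 m <= 0 ->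
  0 <= et1 ^+ 2 - 8 * h * et2 /\ Defs.root1 h et1 et2 <= m <= root2 h et1 et2.
Proof.
move=> h0 Rm.
have D0 : 0 <= et1 ^+ 2 - 8 * h * et2.
  have -> : et1 ^+ 2 - 8 * h * et2 =
    (4 * h * m - et1) ^+ 2 - 8 * h * Rpol h et1 et2 m by rewrite /Rpol; ring.
  have := sqr_ge0 (4 * h * m - et1).
  have : h * Rpol h et1 et2 m <= 0 by rewrite pmulr_rle0.
  by lra.
split=> //; move: Rm; rewrite Rpol_factor// pmulr_rle0; last by lra.
have := root1_le_root2 et1 et2 h0.
set r1 := Defs.root1 _ _ _; set r2 := root2 _ _ _ => r12 mle.
by apply/andP; split; rewrite leNgt; apply/negP => hm;
  move: mle; rewrite leNgt => /negP; apply; nra.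
Qed.

(** Min-max argument: a Rayleigh quotient at a vector with zero first coordinate lies in [[e2,e4]],
    one with zero fourth coordinate in [[e1,e3]], and both separate the roots. The outer bounds
    follow because R is a nonnegative combination of squares at [e1] and at [e4]. *)
Lemma M_h_root_domain e1 e2 e3 e4 h L :
  e1 < e2 -> e2 < e3 -> e3 < e4 -> 0 < h -> M_h h L ->
  let et1 := eta1 e1 e2 e3 e4 L in
  let et2 := eta2 e1 e2 e3 e4 L in
  0 <= et1 ^+ 2 - 8 * h * et2 /\
  root_domain e1 e2 e3 e4 (Defs.root1 h et1 et2) (root2 h et1 et2).
Proof.
move=> e12 e23 e34 h0 hL et1 et2.
have [m1 m1e Rm1] : exists2 m, e2 <= m <= e4 & Rpol h et1 et2 m <= 0.
  have := @Rpol_rayleigh_le0 e1 e2 e3 e4 h L hL.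
  set n := l34 L ^+ 2 + _ + _; set m := e2 * _ + _ + _ => H.
  have [n0|n0] := eqVneq n 0; last first.
    have np : 0 < n by rewrite lt0r n0 /n !addr_ge0 ?sqr_ge0.
    exists (m / n); last exact: H.
    have := sqr_ge0 (l34 L); have := sqr_ge0 (l24 L); have := sqr_ge0 (l23 L).
    rewrite ler_pdivlMr// ler_pdivrMr// /m /n => ? ? ?.
    by apply/andP; split; nra.
  (* The test vector is zero here; only [l12], [l13], [l14] survive, and the sign of R at [e3] is
     read off directly. *)
  exists e3; first by lra.
  have := sqr_ge0 (l34 L); have := sqr_ge0 (l24 L); have := sqr_ge0 (l23 L).
  move=> H1 H2 H3.
  have q1 : l34 L ^+ 2 = 0 by rewrite /n in n0; lra.
  have q2 : l24 L ^+ 2 = 0 by rewrite /n in n0; lra.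
  have q3 : l23 L ^+ 2 = 0 by rewrite /n in n0; lra.
  move: hL => [/= LE _]; rewrite /Rpol -LE /et1 /et2 /eta1 /eta2 q1 q2 q3.
  have -> : forall a b c : R, (a + b + c + 0 + 0 + 0) * e3 ^+ 2 -
     (a * (e3 + e4) + b * (e2 + e4) + c * (e2 + e3) + 0 * (e1 + e4)
       + 0 * (e1 + e3) + 0 * (e1 + e2)) * e3 +
     (a * (e3 * e4) + b * (e2 * e4) + c * (e2 * e3) + 0 * (e1 * e4)
       + 0 * (e1 * e3) + 0 * (e1 * e2)) = - (b * ((e3 - e2) * (e4 - e3))).
    by move=> a b c; ring.
  by rewrite oppr_le0 mulr_ge0 ?sqr_ge0 ?mulr_ge0//; lra.
have [m2 m2e Rm2] : exists2 m, e1 <= m <= e3 & Rpol h et1 et2 m <= 0.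
  (* Index reversal k -> 5 - k, up to a common sign of all entries. The Rayleigh lemma assumes no
     order on the nodes, so it applies to them reversed. *)
  pose L' := mkL (l34 L) (l24 L) (l14 L) (l23 L) (l13 L) (l12 L).
  have hL' : M_h h L' by case: hL => /= A B; split => /=; [rewrite -A|rewrite -B]; ring.
  have := @Rpol_rayleigh_le0 e4 e3 e2 e1 h L' hL'.
  have -> : eta1 e4 e3 e2 e1 L' = et1 by rewrite /et1 /eta1 /=; ring.
  have -> : eta2 e4 e3 e2 e1 L' = et2 by rewrite /et2 /eta2 /=; ring.
  rewrite /=.
  set n := l12 L ^+ 2 + _ + _; set m := e3 * _ + _ + _ => H.
  have [n0|n0] := eqVneq n 0; last first.
    have np : 0 < n by rewrite lt0r n0 /n !addr_ge0 ?sqr_ge0.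
    exists (m / n); last exact: H.
    have := sqr_ge0 (l12 L); have := sqr_ge0 (l13 L); have := sqr_ge0 (l23 L).
    rewrite ler_pdivlMr// ler_pdivrMr// /m /n => ? ? ?.
    by apply/andP; split; nra.
  exists e2; first by lra.
  have := sqr_ge0 (l12 L); have := sqr_ge0 (l13 L); have := sqr_ge0 (l23 L).
  move=> H1 H2 H3.
  have q1 : l12 L ^+ 2 = 0 by rewrite /n in n0; lra.
  have q2 : l13 L ^+ 2 = 0 by rewrite /n in n0; lra.
  have q3 : l23 L ^+ 2 = 0 by rewrite /n in n0; lra.
  move: hL => [/= LE _]; rewrite /Rpol -LE /et1 /et2 /eta1 /eta2 q1 q2 q3.
  have -> : forall a b c : R, (0 + 0 + a + 0 + b + c) * e2 ^+ 2 -
     (0 * (e3 + e4) + 0 * (e2 + e4) + a * (e2 + e3) + 0 * (e1 + e4)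
       + b * (e1 + e3) + c * (e1 + e2)) * e2 +
     (0 * (e3 * e4) + 0 * (e2 * e4) + a * (e2 * e3) + 0 * (e1 * e4)
       + b * (e1 * e3) + c * (e1 * e2)) = - (b * ((e3 - e2) * (e2 - e1))).
    by move=> a b c; ring.
  by rewrite oppr_le0 mulr_ge0 ?sqr_ge0 ?mulr_ge0//; lra.
have [D0 /andP[r1m1 m1r2]] := Rpol_le0_bounds h0 Rm1.
have [_ /andP[r1m2 m2r2]] := Rpol_le0_bounds h0 Rm2.
have R1 : 0 <= Rpol h et1 et2 e1.
  have -> : Rpol h et1 et2 e1 = l12 L ^+ 2 * ((e3 - e1) * (e4 - e1)) +
    l13 L ^+ 2 * ((e2 - e1) * (e4 - e1)) + l14 L ^+ 2 * ((e2 - e1) * (e3 - e1)).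
    by rewrite /Rpol; case: hL => <- _; rewrite /et1 /et2 /eta1 /eta2; ring.
  by rewrite !addr_ge0// mulr_ge0 ?sqr_ge0// mulr_ge0//; lra.
have R4 : 0 <= Rpol h et1 et2 e4.
  have -> : Rpol h et1 et2 e4 = l14 L ^+ 2 * ((e4 - e2) * (e4 - e3)) +
    l24 L ^+ 2 * ((e4 - e1) * (e4 - e3)) + l34 L ^+ 2 * ((e4 - e1) * (e4 - e2)).
    by rewrite /Rpol; case: hL => <- _; rewrite /et1 /et2 /eta1 /eta2; ring.
  by rewrite !addr_ge0// mulr_ge0 ?sqr_ge0// mulr_ge0//; lra.
split=> //; have r12 := root1_le_root2 et1 et2 h0.
have h2 : 0 < 2 * h by lra.
move: R1 R4; rewrite !Rpol_factor// !(pmulr_rge0 _ h2).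
move: r1m1 m1r2 r1m2 m2r2 r12.
set r1 := Defs.root1 _ _ _; set r2 := root2 _ _ _ => r1m1 m1r2 r1m2 m2r2 r12 R1 R4.
split=> //; [|lra|lra|].
- rewrite leNgt; apply/negP => hr; move: R1; rewrite leNgt => /negP; apply.
  by rewrite nmulr_llt0; lra.
- rewrite leNgt; apply/negP => hr; move: R4; rewrite leNgt => /negP; apply.
  by rewrite nmulr_llt0; lra.
Qed.

End roots.

(** * Integrability of inverse square roots *)

Section improper.
Context {R : realType}.
Notation mu := (@lebesgue_measure R).

Lemma integrable_itv_oo_cc (f : R -> R) (a b : R) :
  mu.-integrable `]a, b[ (EFin \o f) -> mu.-integrable `[a, b] (EFin \o f).
Proof.
move=> /integrableP[mf fi]; apply/integrableP.
have mf' : measurable_fun `]a, b[ f by exact/measurable_EFinP.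
split.
  by apply/measurable_EFinP; exact: (measurable_fun_itv_cc mf').
rewrite -integral_itv_bndo_bndc; last first.
  apply: measurableT_comp => //; apply/measurable_EFinP.
  exact: (measurable_fun_itv_co mf').
by rewrite -integral_itv_obnd_cbnd//; exact: measurableT_comp.
Qed.

(** On each compact interval of an exhaustion of []a, b[] the fundamental theorem bounds the
    integral by 2M, and monotone convergence keeps the bound in the limit. *)
Lemma ge0_bounded_primitive_integrable (f F : R -> R) (a b M : R) :
  (forall x : R, x \in `]a, b[ -> 0 <= f x) ->
  (forall x : R, x \in `]a, b[ -> {for x, continuous f}) ->
  (forall x : R, x \in `]a, b[ -> is_derive x 1 F (f x)) ->
  (forall x : R, x \in `]a, b[ -> `|F x| <= M) ->
  mu.-integrable `[a, b] (EFin \o f).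
Proof.
move=> f0 cf dF FM; apply: integrable_itv_oo_cc.
have [ab|ba] := ltP a b; last first.
  by rewrite set_itv_ge ?bnd_simp -?leNgt//; exact: integrable_set0.
have mf : measurable_fun `]a, b[ f.
  apply: open_continuous_measurable_fun; first exact: interval_open.
  by move=> x; rewrite inE/=; exact: cf.
apply/integrableP; split; first exact/measurable_EFinP.
pose ep (n : nat) : R := n.+1%:R^-1.
have ep0 n : 0 < ep n by rewrite invr_gt0.
have ep_ni n m : (n <= m)%N -> ep m <= ep n.
  by move=> nm; rewrite lef_pV2 ?posrE// ler_nat.
have ep_small d : 0 < d -> exists n, ep n < d.
  by move=> d0; have [n] := ltr_add_invr d0; rewrite add0r; exists n.
clearbody ep.
pose E (n : nat) : set R := `[a + ep n, b - ep n]%classic.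
have Eab n : E n `<=` `]a, b[%classic.
  move=> x; rewrite /E /= !in_itv/= => /andP[ax xb].
  by have e0 := ep0 n; apply/andP; split; lra.
have UE : \bigcup_n E n = `]a, b[%classic.
  apply/seteqP; split=> [x [n _ /Eab]//|x /=].
  rewrite in_itv/= => /andP[ax xb].
  pose d := Num.min (x - a) (b - x).
  have d0 : 0 < d by rewrite lt_min !subr_gt0 ax.
  have [n nd] := ep_small _ d0.
  exists n => //; rewrite /E /= in_itv/=.
  move: nd; rewrite lt_min => /andP[? ?].
  by apply/andP; split; lra.
have /= := @ge0_nondecreasing_set_cvg_integral _ (measurableTypeR R) R E
  (fun x => `|(EFin \o f) x|%E) mu.
rewrite UE => H.
have M0 : 0 <= M.
  apply: le_trans (FM ((a + b) / 2) _); first exact: normr_ge0.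
  by rewrite in_itv/=; apply/andP; split; lra.
apply: (@le_lt_trans _ _ (2 * M)%:E); last exact: ltry.
apply: (cvge_to_le (H _ _ _ _)).
- move=> n m nm; apply/subsetPset => x; rewrite /E /= !in_itv/= => /andP[h1 h2].
  have nm' := ep_ni _ _ nm.
  by apply/andP; split; lra.
- by move=> n; exact: measurable_itv.
- move=> n; have mab : measurable (`]a, b[%classic : set (measurableTypeR R)) by [].
  have mfn : measurable_fun (E n) f.
    by apply: (measurable_funS mab (Eab n)); exact mf.
  apply/measurable_EFinP; exact: measurableT_comp.
- by [].
apply: nearW => n.
have [abn|ban] := ltP (a + ep n) (b - ep n); last first.
  have [abn|nab] := eqVneq (a + ep n) (b - ep n).
    rewrite /E abn set_itv1 integral_set1 lee_fin; lra.
  rewrite /E set_itv_ge ?integral_set0 ?lee_fin ?bnd_simp; first by lra.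
  by rewrite -ltNge lt_neqAle eq_sym nab.
rewrite (_ : (\int[mu]_(x in E n) _ = \int[mu]_(x in E n) (f x)%:E)%E); last first.
  apply: eq_integral => x; rewrite inE => /Eab xab.
  by rewrite ger0_norm//; apply: f0.
have dFc x : E n x -> derivable F x 1 /\ {for x, continuous F}.
  move=> /Eab xab; have [dx _] := dF _ xab; split=> //.
  exact/differentiable_continuous/derivable1_diffP.
have cFE : {within E n, continuous F}.
  by apply: continuous_in_subspaceT => x; rewrite inE => /dFc[].
rewrite (@continuous_FTC2 _ _ F)//.
- have /FM : a + ep n \in `]a, b[.
    by apply: (Eab n); rewrite /E /= in_itv/= lexx ltW.
  have /FM : b - ep n \in `]a, b[.
    by apply: (Eab n); rewrite /E /= in_itv/= lexx ltW.
  rewrite -EFinB lee_fin => h1 h2.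
  by have := ler_normB (F (b - ep n)) (F (a + ep n));
    have := ler_norm (F (b - ep n) - F (a + ep n)); lra.
- by apply: continuous_in_subspaceT => x; rewrite inE => /Eab; exact: cf.
- have [_ cl cr] := (continuous_within_itvP F abn).1 cFE.
  split=> // x xE; have [] := dFc x => //.
  by move: xE; rewrite /E /= !in_itv/= => /andP[/ltW -> /ltW ->].
- move=> x xE; rewrite derive1E.
  have : x \in `]a, b[.
    by apply: (Eab n); move: xE; rewrite /E /= !in_itv/= => /andP[/ltW -> /ltW ->].
  by move=> /dF[].
Qed.

Lemma continuous_sqrtV_norm (g : R -> R) x :
  {for x, continuous g} -> g x != 0 ->
  {for x, continuous (fun s => Num.sqrt `|g s|^-1)}.
Proof.
move=> cg g0; apply: (@continuous_comp _ _ _ (fun s => `|g s|^-1)).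
  apply: cvgV; first by rewrite normr_eq0.
  by apply: (@continuous_comp _ _ _ g); [|exact: norm_continuous].
exact: sqrt_continuous.
Qed.

Lemma integrable_sqrtV_subr (a b c : R) : (b <= c) || (c <= a) ->
  mu.-integrable `[a, b] (EFin \o (fun s => Num.sqrt `|s - c|^-1)).
Proof.
have csub x : {for x, continuous (fun s => s - c)}.
  by apply: cvgB; [exact: cvg_id|exact: cvg_cst].
case/orP => [bc|ca].
- have sc (x : R) : x \in `]a, b[ -> 0 < c - x.
    by rewrite in_itv/= => /andP[? ?]; lra.
  apply: (@ge0_bounded_primitive_integrable _
    (fun s => - 2 * Num.sqrt (c - s)) a b (2 * Num.sqrt (c - a))).
  + by move=> x _; exact: sqrtr_ge0.
  + move=> x /sc xc; apply: continuous_sqrtV_norm; first exact: csub.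
    by rewrite lt_eqF//; lra.
  + move=> x /sc xc.
    have d1 : is_derive x 1 (fun s => c - s) (- 1).
      have -> : (- 1 : R) = 0 - 1 by rewrite sub0r.
      exact: is_deriveB.
    have d2 := @is_derive1_comp _ Num.sqrt (fun s => c - s) x _ _ (is_derive1_sqrt xc) d1.
    have := @is_deriveZ _ _ _ _ (- 2) x 1 _ d2.
    rewrite (_ : (- 2) *: _ = Num.sqrt `|x - c|^-1) //.
    rewrite distrC gtr0_norm// sqrtrV ?(ltW xc)//.
    rewrite /GRing.scale/= invfM; field.
    by rewrite gt_eqF// sqrtr_gt0.
  + move=> x xab; have xc := sc _ xab.
    rewrite normrM normrN !ger0_norm ?sqrtr_ge0// ler_pM2l//.
    by apply: ler_wsqrtr; move: xab; rewrite in_itv/= => /andP[? ?]; lra.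
- have sc (x : R) : x \in `]a, b[ -> 0 < x - c.
    by rewrite in_itv/= => /andP[? ?]; lra.
  apply: (@ge0_bounded_primitive_integrable _
    (fun s => 2 * Num.sqrt (s - c)) a b (2 * Num.sqrt (b - c))).
  + by move=> x _; exact: sqrtr_ge0.
  + move=> x /sc xc; apply: continuous_sqrtV_norm; first exact: csub.
    by rewrite gt_eqF//; lra.
  + move=> x /sc xc.
    have d1 : is_derive x 1 (fun s => s - c) 1.
      by apply: is_derive_eq; rewrite subr0.
    have d2 := @is_derive1_comp _ Num.sqrt (fun s => s - c) x _ _ (is_derive1_sqrt xc) d1.
    have := @is_deriveZ _ _ _ _ 2 x 1 _ d2.
    rewrite (_ : 2 *: _ = Num.sqrt `|x - c|^-1) //.
    rewrite gtr0_norm// sqrtrV ?(ltW xc)//.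
    rewrite /GRing.scale/= invfM; field.
    by rewrite gt_eqF// sqrtr_gt0.
  + move=> x xab; have xc := sc _ xab.
    rewrite normrM !ger0_norm ?sqrtr_ge0// ler_pM2l//.
    by apply: ler_wsqrtr; move: xab; rewrite in_itv/= => /andP[? ?]; lra.
Qed.

End improper.

Lemma ler_sqrtD {R : rcfType} (x y : R) :
  Num.sqrt (x + y) <= Num.sqrt x + Num.sqrt y.
Proof.
have [x0|/ltW x0] := leP x 0.
  by rewrite (ler0_sqrtr x0) add0r ler_wsqrtr//; lra.
have [y0|/ltW y0] := leP y 0.
  by rewrite (ler0_sqrtr y0) addr0 ler_wsqrtr//; lra.
rewrite -(@ler_pXn2r _ 2)// ?nnegrE ?addr_ge0 ?sqrtr_ge0//.
rewrite sqrrD !sqr_sqrtr ?addr_ge0//.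
have : 0 <= Num.sqrt x * Num.sqrt y by rewrite mulr_ge0 ?sqrtr_ge0.
by lra.
Qed.

(** A Hoelder bound is what remains available at zeros of the radicand, where the square root is not
    Lipschitz; the roots [r1], [r2] are such zeros. *)
Lemma ler_dist_sqrt {R : rcfType} (x y : R) :
  `|Num.sqrt x - Num.sqrt y| <= Num.sqrt `|x - y|.
Proof.
wlog xy : x y / x <= y.
  by move=> H; have [/H//|/ltW/H] := leP x y; rewrite distrC (distrC y).
rewrite distrC (distrC x) !ger0_norm ?subr_ge0//; last exact: ler_wsqrtr.
by have := ler_sqrtD x (y - x); rewrite addrC subrK; lra.
Qed.

(** * Integrals over fixed gaps and their dependence on the roots *)

Section weight.
Context {R : realType}.
Notation mu := (@lebesgue_measure R).
Implicit Types a b e r s : R.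

(** The absolute value lets one weight serve all three gaps. At a node it is 0, since the inverse of
    0 is 0. *)
Definition weight e1 e2 e3 e4 s := Num.sqrt `|Apol e1 e2 e3 e4 s|^-1.

(** Partial fractions in absolute value: after clearing denominators this is the triangle
    inequality. At a node the left side is 0 by the convention on inverses. *)
Lemma mulVf_dist_le e1 e2 s : e1 != e2 ->
  `|s - e1|^-1 * `|s - e2|^-1 <= `|e1 - e2|^-1 * (`|s - e1|^-1 + `|s - e2|^-1).
Proof.
move=> e12; have [s1|s1] := eqVneq s e1.
  by rewrite s1 subrr normr0 invr0 mul0r add0r mulr_ge0 ?invr_ge0.
have [s2|s2] := eqVneq s e2.
  by rewrite s2 subrr normr0 invr0 mulr0 addr0 mulr_ge0 ?invr_ge0.
have h1 : 0 < `|s - e1| by rewrite normr_gt0 subr_eq0.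
have h2 : 0 < `|s - e2| by rewrite normr_gt0 subr_eq0.
have h3 : 0 < `|e1 - e2| by rewrite normr_gt0 subr_eq0.
have tri : `|e1 - e2| <= `|s - e1| + `|s - e2|.
  by have := ler_distD s e1 e2; rewrite (distrC e1 s).
move: h1 h2 h3 tri; move: `|s - e1| `|s - e2| `|e1 - e2| => x y z x0 y0 z0 tri.
have -> : z^-1 * (x^-1 + y^-1) = (x + y) / z * (x^-1 * y^-1).
  by field; rewrite !gt_eqF.
by rewrite ler_peMl ?mulr_ge0 ?invr_ge0 ?(ltW x0) ?(ltW y0)// ler_pdivlMr// mul1r.
Qed.

Lemma continuous_Apol e1 e2 e3 e4 : continuous (Apol e1 e2 e3 e4).
Proof.
have c e : continuous (fun s => s - e).
  by move=> x; apply: cvgB; [exact: cvg_id|exact: cvg_cst].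
by move=> x; do 3 (apply: cvgM; last exact: c); exact: c.
Qed.

(** Partial fractions on the pairs (1,2) and (3,4), then on the four cross pairs, bound 1/|A| by a
    multiple of the sum of the 1/|s - e_k|; this gives the constant [C]. Subadditivity of the square
    root then separates the nodes. *)
Lemma weight_le e1 e2 e3 e4 : e1 < e2 -> e2 < e3 -> e3 < e4 ->
  exists C : R, forall s, weight e1 e2 e3 e4 s <= C *
    (Num.sqrt `|s - e1|^-1 + Num.sqrt `|s - e2|^-1 +
     Num.sqrt `|s - e3|^-1 + Num.sqrt `|s - e4|^-1).
Proof.
move=> e12 e23 e34.
pose k (x y : R) := `|x - y|^-1.
pose C := k e1 e2 * k e3 e4 * (k e1 e3 + k e1 e4 + k e2 e3 + k e2 e4).
have k0 x y : 0 <= k x y by rewrite invr_ge0.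
exists (Num.sqrt C) => s.
have C0 : 0 <= C by rewrite /C !mulr_ge0// !addr_ge0.
have AC : `|Apol e1 e2 e3 e4 s|^-1 <= C * (k s e1 + k s e2 + k s e3 + k s e4).
  have neq (x y : R) : x < y -> x != y by move=> ?; rewrite lt_eqF.
  have h12 := mulVf_dist_le s (neq _ _ e12).
  have h34 := mulVf_dist_le s (neq _ _ e34).
  have h13 := mulVf_dist_le s (neq _ _ (lt_trans e12 e23)).
  have h24 := mulVf_dist_le s (neq _ _ (lt_trans e23 e34)).
  have h14 := mulVf_dist_le s (neq _ _ (lt_trans e12 (lt_trans e23 e34))).
  have h23 := mulVf_dist_le s (neq _ _ e23).
  rewrite /Apol !normrM !invfM -!/(k _ _) in h12 h34 h13 h24 h14 h23 *.
  have u1 := k0 s e1; have u2 := k0 s e2; have u3 := k0 s e3; have u4 := k0 s e4.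
  have H : (k s e1 + k s e2) * (k s e3 + k s e4) <=
      (k e1 e3 + k e1 e4 + k e2 e3 + k e2 e4) *
      (k s e1 + k s e2 + k s e3 + k s e4).
    have q13 := k0 e1 e3; have q14 := k0 e1 e4.
    have q23 := k0 e2 e3; have q24 := k0 e2 e4.
    have m (x y : R) : 0 <= x -> 0 <= y -> 0 <= x * y by exact: mulr_ge0.
    have := (m _ _ q13 u2, m _ _ q13 u4, m _ _ q14 u2, m _ _ q14 u3).
    have := (m _ _ q23 u1, m _ _ q23 u4, m _ _ q24 u1, m _ _ q24 u3).
    move=> [[[? ?] ?] ?] [[[? ?] ?] ?].
    by rewrite !mulrDl !mulrDr in h13 h14 h23 h24 *; lra.
  have -> : k s e1 * k s e2 * k s e3 * k s e4 =
    (k s e1 * k s e2) * (k s e3 * k s e4) by ring.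
  apply: (le_trans (ler_pM _ _ h12 h34)); rewrite ?mulr_ge0//.
  have -> : k e1 e2 * (k s e1 + k s e2) * (k e3 e4 * (k s e3 + k s e4)) =
    k e1 e2 * k e3 e4 * ((k s e1 + k s e2) * (k s e3 + k s e4)) by ring.
  by rewrite /C -[leRHS]mulrA ler_wpM2l// mulr_ge0.
rewrite /weight; apply: (le_trans (ler_wsqrtr AC)).
rewrite sqrtrM// ler_wpM2l ?sqrtr_ge0//.
apply: (le_trans (ler_sqrtD _ _)); rewrite lerD2r.
apply: (le_trans (ler_sqrtD _ _)); rewrite lerD2r.
exact: ler_sqrtD.
Qed.

Lemma Apol_neq0 e1 e2 e3 e4 s :
  (Apol e1 e2 e3 e4 s != 0) = [&& s != e1, s != e2, s != e3 & s != e4].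
Proof. by rewrite /Apol !mulf_eq0 !subr_eq0 !negb_or -!andbA. Qed.

Definition free_of_nodes e1 e2 e3 e4 a b :=
  all (fun e => (b <= e) || (e <= a)) [:: e1; e2; e3; e4].

Lemma free_of_nodes_neq0 e1 e2 e3 e4 a b s : free_of_nodes e1 e2 e3 e4 a b ->
  s \in `]a, b[ -> Apol e1 e2 e3 e4 s != 0.
Proof.
rewrite /free_of_nodes /= andbT in_itv/= Apol_neq0.
move=> /and4P[h1 h2 h3 h4] /andP[sa sb].
have n e : (b <= e) || (e <= a) -> s != e.
  by case/orP => ?; [rewrite lt_eqF|rewrite gt_eqF]; lra.
by rewrite !n.
Qed.

Lemma continuous_weight e1 e2 e3 e4 s : Apol e1 e2 e3 e4 s != 0 ->
  {for s, continuous (weight e1 e2 e3 e4)}.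
Proof.
by move=> A0; apply: continuous_sqrtV_norm => //; exact: continuous_Apol.
Qed.

Lemma integrable_weight e1 e2 e3 e4 a b : e1 < e2 -> e2 < e3 -> e3 < e4 ->
  free_of_nodes e1 e2 e3 e4 a b ->
  mu.-integrable `[a, b] (EFin \o weight e1 e2 e3 e4).
Proof.
move=> e12 e23 e34 fr; have [C HC] := weight_le e12 e23 e34.
pose g s := C * (Num.sqrt `|s - e1|^-1 + Num.sqrt `|s - e2|^-1 +
     Num.sqrt `|s - e3|^-1 + Num.sqrt `|s - e4|^-1).
have ig : mu.-integrable `[a, b] (EFin \o g).
  have mab : measurable (`[a, b]%classic : set (measurableTypeR R)) by [].
  move: (fr); rewrite /free_of_nodes /= andbT => /and4P[h1 h2 h3 h4].
  pose k e s := Num.sqrt `|s - e|^-1.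
  have -> : EFin \o g = (fun s => C%:E * (((EFin \o k e1) \+ (EFin \o k e2) \+
     (EFin \o k e3) \+ (EFin \o k e4)) s))%E.
    by apply/funext => s; rewrite /g /= EFinM !EFinD.
  apply: integrableZl => //.
  by do 3 (apply: integrableD => //; last exact: integrable_sqrtV_subr);
    exact: integrable_sqrtV_subr.
apply: (le_integrable _ _ _ ig) => //.
  apply/measurable_EFinP; apply: (@measurable_fun_itv_cc _ _ _ false true).
  apply: open_continuous_measurable_fun; first exact: interval_open.
  move=> x; rewrite inE/= => xab; apply: continuous_weight.
  exact: free_of_nodes_neq0 xab.
move=> x _; rewrite /= lee_fin ger0_norm ?sqrtr_ge0//.
exact: le_trans (HC x) (ler_norm _).
Qed.

(** Integral of sqrt(- N / A) with the limits of integration fixed: [sg] is opposite to the sign of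
    A on the gap (1, -1, 1 in turn), and the clipped square root discards the part of the gap
    outside the original limits. *)
Definition wint e1 e2 e3 e4 sg a b r1 r2 :=
  (\int[mu]_(s in `[a, b])
     (Num.sqrt (sg * ((s - r1) * (s - r2))) * weight e1 e2 e3 e4 s))%R.

Lemma continuous_sqrt_quad sg r1 r2 :
  continuous (fun s : R => Num.sqrt (sg * ((s - r1) * (s - r2)))).
Proof.
have c e : continuous (fun s => s - e).
  by move=> x; apply: cvgB; [exact: cvg_id|exact: cvg_cst].
move=> x; apply: (@continuous_comp _ _ _ (fun s => sg * ((s - r1) * (s - r2)))).
  by apply: cvgM; [exact: cvg_cst|apply: cvgM; exact: c].
exact: sqrt_continuous.
Qed.

Lemma integrable_wint e1 e2 e3 e4 sg a b r1 r2 :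
  e1 < e2 -> e2 < e3 -> e3 < e4 -> free_of_nodes e1 e2 e3 e4 a b ->
  mu.-integrable `[a, b]
    (EFin \o (fun s => Num.sqrt (sg * ((s - r1) * (s - r2))) * weight e1 e2 e3 e4 s)).
Proof.
move=> e12 e23 e34 fr; have iw := integrable_weight e12 e23 e34 fr.
have mab : measurable (`[a, b]%classic : set (measurableTypeR R)) by [].
set h := fun s : R => Num.sqrt (sg * ((s - r1) * (s - r2))).
have -> : EFin \o (fun s => h s * weight e1 e2 e3 e4 s) =
  ((EFin \o h) \* (EFin \o weight e1 e2 e3 e4))%E.
  by apply/funext => s /=; rewrite EFinM.
have ch := @continuous_sqrt_quad sg r1 r2.
apply: integrableMr => //.
  by apply: measurable_funTS; apply: continuous_measurable_fun.
have cw : {within `[a, b], continuous h} by exact: continuous_subspaceT.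
have /compact_bounded[M [_ mrt]] := continuous_compact cw (@segment_compact _ a b).
by exists M; split; rewrite ?num_real // => ? ? ? ?; apply: mrt => //; eexists; eauto.
Qed.

Lemma le_wint e1 e2 e3 e4 sg a b r1 r2 r1' r2' :
  e1 < e2 -> e2 < e3 -> e3 < e4 -> free_of_nodes e1 e2 e3 e4 a b ->
  (forall s : R, s \in `[a, b] -> Num.sqrt (sg * ((s - r1) * (s - r2))) <=
     Num.sqrt (sg * ((s - r1') * (s - r2')))) ->
  wint e1 e2 e3 e4 sg a b r1 r2 <= wint e1 e2 e3 e4 sg a b r1' r2'.
Proof.
move=> e12 e23 e34 fr H; apply: le_Rintegral => //; [exact: integrable_wint..|].
by move=> s sab; rewrite ler_wpM2r ?sqrtr_ge0//; exact: H.
Qed.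

(** The difference of two radicands is affine in [s], its coefficients being the changes of the sum
    and of the product of the roots, and [|s| <= |a| + |b|]. The Hoelder bound of the square root is
    then integrated against the weight. *)
Lemma dist_wint e1 e2 e3 e4 sg a b r1 r2 r1' r2' :
  e1 < e2 -> e2 < e3 -> e3 < e4 -> free_of_nodes e1 e2 e3 e4 a b ->
  `|wint e1 e2 e3 e4 sg a b r1 r2 - wint e1 e2 e3 e4 sg a b r1' r2'| <=
  Num.sqrt (`|sg| * ((`|a| + `|b|) * `|(r1' + r2') - (r1 + r2)| + `|r1 * r2 - r1' * r2'|)) *
  (\int[mu]_(s in `[a, b]) weight e1 e2 e3 e4 s)%R.
Proof.
move=> e12 e23 e34 fr; set D := _ * (_ + _).
have iw := integrable_weight e12 e23 e34 fr.
have i1 := integrable_wint sg r1 r2 e12 e23 e34 fr.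
have i2 := integrable_wint sg r1' r2' e12 e23 e34 fr.
have mab : measurable (`[a, b]%classic : set (measurableTypeR R)) by [].
rewrite /wint -RintegralB// -RintegralZl//.
have i12 := integrableB mab i1 i2.
apply: (le_trans (le_normr_Rintegral _ _)) => //.
apply: le_Rintegral => //.
- exact: (integrable_norm i12).
- exact: (integrableZl mab (Num.sqrt D) iw).
move=> s sab; rewrite -mulrBl normrM (ger0_norm (sqrtr_ge0 _)).
rewrite ler_wpM2r ?sqrtr_ge0//.
apply: (le_trans (ler_dist_sqrt _ _)); apply: ler_wsqrtr.
rewrite -mulrBr normrM ler_wpM2l//.
have -> : (s - r1) * (s - r2) - (s - r1') * (s - r2') =
  s * ((r1' + r2') - (r1 + r2)) + (r1 * r2 - r1' * r2') by ring.
apply: (le_trans (ler_normD _ _)); rewrite lerD2r normrM ler_wpM2r//.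
move: sab; rewrite /= in_itv/= => /andP[sa sb].
rewrite ler_norml; have := ler_norm b; have := ler_norm (- a); rewrite normrN.
by have := normr_ge0 a; have := normr_ge0 b => ? ? ? ?; apply/andP; split; lra.
Qed.

Lemma cvg_wint {T : Type} (F : set_system T) (FF : Filter F)
    (f1 f2 : T -> R) e1 e2 e3 e4 sg a b r1 r2 :
  e1 < e2 -> e2 < e3 -> e3 < e4 -> free_of_nodes e1 e2 e3 e4 a b ->
  f1 @ F --> r1 -> f2 @ F --> r2 ->
  wint e1 e2 e3 e4 sg a b (f1 t) (f2 t) @[t --> F] -->
  wint e1 e2 e3 e4 sg a b r1 r2.
Proof.
move=> e12 e23 e34 fr c1 c2; apply/cvgrPdist_le => /=.
set W := (\int[mu]_(s in `[a, b]) weight e1 e2 e3 e4 s)%R.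
pose D t := Num.sqrt (`|sg| * ((`|a| + `|b|) * `|(f1 t + f2 t) - (r1 + r2)| +
  `|r1 * r2 - f1 t * f2 t|)) * W.
have cD : D @ F --> 0.
  have -> : 0 = Num.sqrt (`|sg| * ((`|a| + `|b|) * `|(r1 + r2) - (r1 + r2)| +
      `|r1 * r2 - r1 * r2|)) * W.
    by rewrite !subrr normr0 mulr0 addr0 mulr0 sqrtr0 mul0r.
  apply: cvgM; last exact: cvg_cst.
  apply: continuous_cvg; first exact: sqrt_continuous.
  apply: cvgM; first exact: cvg_cst.
  apply: cvgD.
    apply: cvgM; first exact: cvg_cst.
    by apply: cvg_norm; apply: cvgB; [exact: cvgD|exact: cvg_cst].
  by apply: cvg_norm; apply: cvgB; [exact: cvg_cst|exact: cvgM].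
move=> e e0; near=> t.
have Dt : `|0 - D t| <= e by near: t; move/cvgrPdist_le : cD; apply.
move: Dt; rewrite sub0r normrN => Dt.
apply: (le_trans (dist_wint _ _ _ _ _ e12 e23 e34 fr)).
exact: le_trans (ler_norm _) Dt.
Unshelve. all: by end_near. Qed.

End weight.

Lemma within_continuous_comp_in {U V W : topologicalType} (A : set U)
    (B : set V) (f : U -> V) (g : V -> W) :
  (forall x, A x -> B (f x)) -> {within A, continuous f} ->
  {within B, continuous g} -> {within A, continuous (g \o f)}.
Proof.
move=> AB /subspace_continuousP cf /subspace_continuousP cg.
apply/subspace_continuousP => x Ax.
have := cg _ (AB _ Ax) => cgx N /cgx cgN.
have := cf _ Ax _ cgN; rewrite /= !nbhs_simpl /within /= => H.
near=> z => Az; have : A z -> B (f z) -> N (g (f z)) by near: z.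
by apply=> //; exact: AB.
Unshelve. all: by end_near. Qed.

(** * Change of variables along a monotone branch *)

Section branch.
Context {R : realType}.
Notation mu := (@lebesgue_measure R).
Implicit Types (a b x t : R) (T dT g : R -> R).

(* X is the inverse of T and Phi t the integral of g from a to X t. *)
Lemma increasing_branch a b T dT g : a < b ->
  {within `[a, b], continuous T} -> T a = 0 -> T b = 1 ->
  (forall x, x \in `]a, b[ -> is_derive x 1 T (dT x)) ->
  (forall x, x \in `]a, b[ -> 0 < dT x) ->
  mu.-integrable `[a, b] (EFin \o g) ->
  (forall x, x \in `]a, b[ -> {for x, continuous g}) ->
  exists X Phi : R -> R,
  [/\ (forall t, 0 < t < 1 -> (X t \in `]a, b[) /\ T (X t) = t),
      {within `[0, 1], continuous Phi},
      (forall t, 0 < t < 1 -> is_derive t 1 Phi (g (X t) / dT (X t)))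
    & Phi 1 - Phi 0 = (\int[mu]_(x in `[a, b]) g x)%R].
Proof.
move=> ab cT Ta Tb dTP dT0 ig cg.
have Tinc : {in `[a, b] &, {homo T : x y / x < y}}.
  apply: gtr0_derive1_lt_cc => // x xab; first by have [] := dTP _ xab.
  by rewrite derive1E; have [_ ->] := dTP _ xab; exact: dT0.
have Tinj : {in `[a, b] &, injective T}.
  move=> x y xab yab Txy; have [xy|xy|//] := ltgtP x y.
    by have := Tinc _ _ xab yab xy; rewrite Txy ltxx.
  by have := Tinc _ _ yab xab xy; rewrite Txy ltxx.
(* The default [a] keeps [X t] in [[a, b]] for every [t], in the range of [T] or not. *)
pose X t := xget a [set x | a <= x <= b /\ T x = t].
have TK : {in `[a, b], cancel T X}.
  move=> x xab; rewrite /X; case: xgetP => [y _ [yab Tyx]|H].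
    exact: Tinj.
  by exfalso; apply: (H x).
have XK := segment_continuous_le_can_sym (ltW ab) cT TK.
have cX := segment_can_le_continuous (ltW ab) cT TK.
rewrite Ta Tb in XK cX.
have aab : a \in `[a, b] by rewrite in_itv/= lexx ltW.
have bab : b \in `[a, b] by rewrite in_itv/= lexx ltW.
have X0 : X 0 = a by rewrite -Ta TK.
have X1 : X 1 = b by rewrite -Tb TK.
have Xab t : X t \in `[a, b].
  by rewrite /X; case: xgetP => [y _ [yab _]//|_].
have Xoo t : 0 < t < 1 -> (X t \in `]a, b[) /\ T (X t) = t.
  move=> t01; have TX : T (X t) = t.
    by apply: XK; move: t01; rewrite in_itv/= => /andP[/ltW -> /ltW ->].
  split=> //; move: (Xab t) t01; rewrite !in_itv/= => /andP[aX Xb] /andP[t0 t1].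
  rewrite !lt_neqAle aX Xb !andbT; apply/andP; split; apply/eqP => XE.
    by move: TX; rewrite -XE Ta => tE; lra.
  by move: TX; rewrite XE Tb => tE; lra.
pose F x := (\int[mu]_(s in `[a, x]) g s)%R.
exists X, (F \o X); split=> //.
- apply: (@within_continuous_comp_in _ _ _ _ `[a, b]%classic) => //.
  by move=> x _; exact: Xab.
  exact: (parameterized_integral_continuous (ltW ab) ig).
- move=> t t01; have [Xtab TX] := Xoo _ t01.
  apply: (@is_derive1_comp _ F X).
    move: (Xtab); rewrite in_itv/= => /andP[aX Xb].
    have [dF FE] := @continuous_FTC1_closed _ g a (X t) b Xb ig aX (cg _ Xtab).
    by rewrite -FE derive1E; exact: derivableP.
  rewrite -[in X in is_derive X]TX; apply: is_derive_inverse; last first.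
  + by rewrite gt_eqF// dT0.
  + exact: dTP.
  + near=> y; have [dy _] : is_derive y 1 T (dT y).
      by apply: dTP; near: y; exact: near_in_itvoo.
    exact/differentiable_continuous/derivable1_diffP.
  + near=> y; apply: TK.
    have : y \in `]a, b[ by near: y; exact: near_in_itvoo.
    by rewrite !in_itv/= => /andP[/ltW -> /ltW ->].
- by rewrite /= X0 X1 /F set_itv1 Rintegral_set1 subr0.
Unshelve. all: by end_near. Qed.

(** Apply the increasing case to [1 - T] and compose with t -> 1 - t: the two signs cancel in the
    derivative, while the total increment is reversed. *)
Lemma decreasing_branch a b T dT g : a < b ->
  {within `[a, b], continuous T} -> T a = 1 -> T b = 0 ->
  (forall x, x \in `]a, b[ -> is_derive x 1 T (dT x)) ->
  (forall x, x \in `]a, b[ -> dT x < 0) ->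
  mu.-integrable `[a, b] (EFin \o g) ->
  (forall x, x \in `]a, b[ -> {for x, continuous g}) ->
  exists X Phi : R -> R,
  [/\ (forall t, 0 < t < 1 -> (X t \in `]a, b[) /\ T (X t) = t),
      {within `[0, 1], continuous Phi},
      (forall t, 0 < t < 1 -> is_derive t 1 Phi (g (X t) / dT (X t)))
    & Phi 1 - Phi 0 = - (\int[mu]_(x in `[a, b]) g x)%R].
Proof.
move=> ab cT Ta Tb dTP dT0 ig cg.
have cT' : {within `[a, b], continuous (fun x => 1 - T x)}.
  by move=> x; apply: cvgB; [exact: cvg_cst|exact: cT].
have Ta' : 1 - T a = 0 by rewrite Ta subrr.
have Tb' : 1 - T b = 1 by rewrite Tb subr0.
have dTP' x : x \in `]a, b[ -> is_derive x 1 (fun x => 1 - T x) (- dT x).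
  move=> xab; have dx := dTP _ xab.
  by rewrite -(sub0r (dT x)); exact: is_deriveB.
have dT0' x : x \in `]a, b[ -> 0 < - dT x by move=> /dT0; rewrite oppr_gt0.
have [X [Phi [XP cPhi dPhi PhiE]]] :=
  increasing_branch ab cT' Ta' Tb' dTP' dT0' ig cg.
have H t : 0 < t < 1 -> 0 < 1 - t < 1.
  by move=> /andP[? ?]; apply/andP; split; lra.
exists (fun t => X (1 - t)), (Phi \o (fun t => 1 - t)); split.
- by move=> t /H/XP[-> XE]; split=> //; move: XE; lra.
- apply: (@within_continuous_comp_in R R R `[0, 1]%classic `[0, 1]%classic
    (fun t : R => 1 - t) Phi) => //.
    by move=> t /=; rewrite !in_itv/= => /andP[? ?]; apply/andP; split; lra.
  by apply: continuous_subspaceT => t; apply: cvgB; [exact: cvg_cst|exact: cvg_id].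
- move=> t /H/dPhi dP.
  have d1 : is_derive t 1 (fun s : R => 1 - s) (- 1).
    by rewrite -(sub0r 1); exact: is_deriveB.
  have := @is_derive1_comp _ Phi (fun s : R => 1 - s) t _ _ dP d1.
  by rewrite mulrN1 invrN mulrN opprK.
- by rewrite /= subrr subr0 -PhiE opprB.
Qed.

End branch.

(** * The pencil of cubics and the value pi *)

Section six_points.
Context {R : realType}.
Notation mu := (@lebesgue_measure R).
Implicit Types (m n x t z : R).

(** Vieta by divided differences: [q] is the first divided difference of [C] at [x1], and
    [x1 + x2 + x3 + a] the second. *)
Lemma monic_cubic_roots (a b c x1 x2 x3 : R) :
  let C z := z ^+ 3 + a * z ^+ 2 + b * z + c in
  x1 != x2 -> x1 != x3 -> x2 != x3 -> C x1 = 0 -> C x2 = 0 -> C x3 = 0 ->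
  a = - (x1 + x2 + x3) /\ b = x1 * x2 + x1 * x3 + x2 * x3.
Proof.
move=> C n12 n13 n23 C1 C2 C3.
have d12 : x1 - x2 != 0 by rewrite subr_eq0.
have d13 : x1 - x3 != 0 by rewrite subr_eq0.
have d23 : x2 - x3 != 0 by rewrite subr_eq0.
pose q y := x1 ^+ 2 + x1 * y + y ^+ 2 + a * (x1 + y) + b.
have q2 : q x2 = 0.
  apply: (mulfI d12); rewrite mulr0.
  transitivity (C x1 - C x2); first by rewrite /C /q; ring.
  by rewrite C1 C2 subrr.
have q3 : q x3 = 0.
  apply: (mulfI d13); rewrite mulr0.
  transitivity (C x1 - C x3); first by rewrite /C /q; ring.
  by rewrite C1 C3 subrr.
have q0 : x1 + x2 + x3 + a = 0.
  apply: (mulfI d23); rewrite mulr0.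
  transitivity (q x2 - q x3); first by rewrite /q; ring.
  by rewrite q2 q3 subrr.
have aE : a = - (x1 + x2 + x3) by move: q0; lra.
split=> //; transitivity (b - q x2); first by rewrite q2 subr0.
by rewrite /q aE; ring.
Qed.

(* Lagrange interpolation of the monic quadratic N at the roots of C. *)
Lemma sum_quad_over_cubic_derive (a b c m n x1 x2 x3 : R) :
  let C z := z ^+ 3 + a * z ^+ 2 + b * z + c in
  let dC z := 3 * z ^+ 2 + 2 * a * z + b in
  let N z := z ^+ 2 + m * z + n in
  x1 != x2 -> x1 != x3 -> x2 != x3 -> C x1 = 0 -> C x2 = 0 -> C x3 = 0 ->
  N x1 / dC x1 + N x2 / dC x2 + N x3 / dC x3 = 1.
Proof.
move=> C dC N n12 n13 n23 C1 C2 C3.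
have [aE bE] := monic_cubic_roots n12 n13 n23 C1 C2 C3.
have d12 : x1 - x2 != 0 by rewrite subr_eq0.
have d13 : x1 - x3 != 0 by rewrite subr_eq0.
have d23 : x2 - x3 != 0 by rewrite subr_eq0.
have -> : dC x1 = (x1 - x2) * (x1 - x3) by rewrite /dC aE bE; ring.
have -> : dC x2 = - ((x1 - x2) * (x2 - x3)) by rewrite /dC aE bE; ring.
have -> : dC x3 = (x1 - x3) * (x2 - x3) by rewrite /dC aE bE; ring.
by rewrite /N; field; rewrite d12 d13 d23.
Qed.

Definition cub (a b c z : R) := (z - a) * (z - b) * (z - c).
Definition dcub (a b c z : R) :=
  (z - b) * (z - c) + (z - a) * (z - c) + (z - a) * (z - b).

Lemma is_derive_cub a b c z : is_derive z 1 (cub a b c) (dcub a b c z).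
Proof.
have d e : is_derive z 1 (fun s : R => s - e) 1.
  by apply: is_derive_eq; rewrite subr0.
have d1 := @is_deriveM _ _ _ _ z 1 _ _ (d a) (d b).
have d2 := @is_deriveM _ _ _ _ z 1 _ _ d1 (d c).
apply: (@is_derive_eq _ _ _ (cub a b c) _ _ _ _ d2); rewrite /dcub fctE /GRing.scale /=; ring.
Qed.

Lemma is_derive_cub_ratio a b c a' b' c' z :
  cub a b c z - cub a' b' c' z != 0 ->
  is_derive z 1 (fun s => cub a b c s / (cub a b c s - cub a' b' c' s))
    ((cub a b c z * dcub a' b' c' z - dcub a b c z * cub a' b' c' z) /
     (cub a b c z - cub a' b' c' z) ^+ 2).
Proof.
move=> D0; have d0 := is_derive_cub a b c z; have d1 := is_derive_cub a' b' c' z.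
have dD := @is_deriveB _ _ _ _ _ z 1 _ _ d0 d1.
have dV := @is_deriveV _ (fun s => cub a b c s - cub a' b' c' s) z _ 1 D0 dD.
have d2 := @is_deriveM _ _ _ _ z 1 _ _ d0 dV.
by apply: (is_derive_eq d2); rewrite /GRing.scale /=; field.
Qed.

(** On each of the three closed intervals the first cubic is nonnegative and the second nonpositive,
    and they vanish at opposite ends. So the pencil parameter P0 / (P0 - P1) is defined up to the
    endpoints. *)
Lemma cub_gap_gt0 x1 x2 x3 x4 x5 x6 z :
  x1 < x2 -> x2 < x3 -> x3 < x4 -> x4 < x5 -> x5 < x6 ->
  [|| x1 <= z <= x2, x3 <= z <= x4 | x5 <= z <= x6] ->
  0 < cub x1 x4 x5 z - cub x2 x3 x6 z.
Proof.
move=> x12 x23 x34 x45 x56.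
have H (a b c d : R) : 0 <= a -> 0 <= c -> 0 < a + c -> 0 < b -> 0 < d ->
    0 < a * b + c * d.
  move=> a0 c0 ac b0 d0; have [az|az] := ltP 0 a.
    by apply: ltr_pwDl; [exact: mulr_gt0|exact: mulr_ge0 (ltW d0)].
  by apply: ltr_wpDl; [exact: mulr_ge0 (ltW b0)|apply: mulr_gt0 => //; lra].
case/or3P => /andP[? ?].
- have -> : cub x1 x4 x5 z - cub x2 x3 x6 z = (z - x1) * ((x4 - z) * (x5 - z)) +
      (x2 - z) * ((x3 - z) * (x6 - z)) by rewrite /cub; ring.
  by apply: H; try (apply: mulr_gt0); lra.
- have -> : cub x1 x4 x5 z - cub x2 x3 x6 z = (x4 - z) * ((z - x1) * (x5 - z)) +
      (z - x3) * ((z - x2) * (x6 - z)) by rewrite /cub; ring.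
  by apply: H; try (apply: mulr_gt0); lra.
- have -> : cub x1 x4 x5 z - cub x2 x3 x6 z = (z - x5) * ((z - x1) * (z - x4)) +
      (x6 - z) * ((z - x2) * (z - x3)) by rewrite /cub; ring.
  by apply: H; try (apply: mulr_gt0); lra.
Qed.

(** The numerator of the derivative of P0 / (P0 - P1); its sign decides the direction of each
    branch. *)
Definition wronskian_cub (a b c a' b' c' z : R) :=
  cub a b c z * dcub a' b' c' z - dcub a b c z * cub a' b' c' z.

(** Divided by P0 P1, the Wronskian is the sum of 1/(z - x) over the roots of P1 minus that over the
    roots of P0. Pairing [x1] with [x6], [x3] with [x4] and [x2] with [x5] gives three terms of one
    sign. *)
Lemma wronskian_cub_lt0 x1 x2 x3 x4 x5 x6 z :
  x1 < x2 -> x2 < x3 -> x3 < x4 -> x4 < x5 -> x5 < x6 ->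
  (x1 < z < x2) || (x5 < z < x6) -> wronskian_cub x2 x3 x6 x1 x4 x5 z < 0.
Proof.
move=> x12 x23 x34 x45 x56 /orP[|] /andP[? ?]; rewrite -oppr_gt0.
  have -> : - wronskian_cub x2 x3 x6 x1 x4 x5 z =
    (x6 - x1) * ((x4 - z) * (x5 - z) * (x2 - z) * (x3 - z))
    + (x4 - x3) * ((z - x1) * (x5 - z) * (x2 - z) * (x6 - z))
    + (x5 - x2) * ((z - x1) * (x4 - z) * (x3 - z) * (x6 - z)).
    by rewrite /wronskian_cub /cub /dcub; ring.
  by rewrite !addr_gt0// !mulr_gt0//; lra.
have -> : - wronskian_cub x2 x3 x6 x1 x4 x5 z =
  (x6 - x1) * ((z - x4) * (z - x5) * (z - x2) * (z - x3))
  + (x4 - x3) * ((z - x1) * (z - x5) * (z - x2) * (x6 - z))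
  + (x5 - x2) * ((z - x1) * (z - x4) * (z - x3) * (x6 - z)).
  by rewrite /wronskian_cub /cub /dcub; ring.
by rewrite !addr_gt0// !mulr_gt0//; lra.
Qed.

(** The same partial fractions, with neighbouring roots paired: [x1] with [x2], [x3] with [x4], [x5]
    with [x6]. *)
Lemma wronskian_cub_gt0 x1 x2 x3 x4 x5 x6 z :
  x1 < x2 -> x2 < x3 -> x3 < x4 -> x4 < x5 -> x5 < x6 ->
  x3 < z < x4 -> 0 < wronskian_cub x2 x3 x6 x1 x4 x5 z.
Proof.
move=> x12 x23 x34 x45 x56 /andP[? ?].
have -> : wronskian_cub x2 x3 x6 x1 x4 x5 z =
  (x2 - x1) * ((x4 - z) * (x5 - z) * (z - x3) * (x6 - z))
  + (x4 - x3) * ((z - x1) * (x5 - z) * (z - x2) * (x6 - z))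
  + (x6 - x5) * ((z - x1) * (x4 - z) * (z - x2) * (z - x3)).
  by rewrite /wronskian_cub /cub /dcub; ring.
by rewrite !addr_gt0// !mulr_gt0//; lra.
Qed.

(* For t = (1 - cos theta) / 2, the pencil C_t = t P1 + (1 - t) P0 has one root
   X_k(t) in each interval, and N / sqrt(- P0 P1) dX_k = - N(X_k) / C_t'(X_k) dtheta;
   the right-hand sides sum to -dtheta. *)
Lemma six_points_integral (x1 x2 x3 x4 x5 x6 r1 r2 : R) (g : R -> R) :
  x1 < x2 -> x2 < x3 -> x3 < x4 -> x4 < x5 -> x5 < x6 ->
  let P z := cub x2 x3 x6 z * cub x1 x4 x5 z in
  let N z := (z - r1) * (z - r2) in
  mu.-integrable `[x1, x2] (EFin \o g) ->
  mu.-integrable `[x3, x4] (EFin \o g) ->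
  mu.-integrable `[x5, x6] (EFin \o g) ->
  (forall x, x \in `]x1, x2[ -> {for x, continuous g}) ->
  (forall x, x \in `]x3, x4[ -> {for x, continuous g}) ->
  (forall x, x \in `]x5, x6[ -> {for x, continuous g}) ->
  (forall x, x \in `]x1, x2[ -> g x = N x / Num.sqrt (- P x)) ->
  (forall x, x \in `]x3, x4[ -> g x = - N x / Num.sqrt (- P x)) ->
  (forall x, x \in `]x5, x6[ -> g x = N x / Num.sqrt (- P x)) ->
  (\int[mu]_(x in `[x1, x2]) g x + \int[mu]_(x in `[x3, x4]) g x +
   \int[mu]_(x in `[x5, x6]) g x = pi)%R.
Proof.
move=> x12 x23 x34 x45 x56 P N i1 i2 i3 c1 c2 c3 g1 g2 g3.
pose P0 := cub x2 x3 x6; pose P1 := cub x1 x4 x5.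
pose dP0 := dcub x2 x3 x6; pose dP1 := dcub x1 x4 x5.
(* [T z] is the parameter t for which [z] is a root of t P1 + (1 - t) P0. *)
pose T z := P0 z / (P0 z - P1 z).
pose W := wronskian_cub x2 x3 x6 x1 x4 x5.
pose dT z := W z / (P0 z - P1 z) ^+ 2.
have D1 z : x1 <= z <= x2 -> 0 < P1 z - P0 z.
  by move=> H; apply: cub_gap_gt0; rewrite ?H.
have D2 z : x3 <= z <= x4 -> 0 < P1 z - P0 z.
  by move=> H; apply: cub_gap_gt0; rewrite ?H ?orbT.
have D3 z : x5 <= z <= x6 -> 0 < P1 z - P0 z.
  by move=> H; apply: cub_gap_gt0; rewrite ?H ?orbT.
have W1 z : x1 < z < x2 -> W z < 0.
  by move=> H; apply: wronskian_cub_lt0; rewrite ?H.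
have W2 z : x3 < z < x4 -> 0 < W z by exact: wronskian_cub_gt0.
have W3 z : x5 < z < x6 -> W z < 0.
  by move=> H; apply: wronskian_cub_lt0; rewrite ?H ?orbT.
have dTD z : 0 < P1 z - P0 z -> is_derive z 1 T (dT z).
  by move=> D; apply: is_derive_cub_ratio; rewrite lt_eqF//; move: D; rewrite /P0 /P1; lra.
have cTD (a b : R) : (forall z, a <= z <= b -> 0 < P1 z - P0 z) ->
    {within `[a, b], continuous T}.
  move=> H; apply: continuous_in_subspaceT => z; rewrite inE /= in_itv/= => /H/dTD[dz _].
  exact/differentiable_continuous/derivable1_diffP.
have dTneg z : 0 < P1 z - P0 z -> W z < 0 -> dT z < 0.
  by move=> D w; rewrite /dT pmulr_llt0// invr_gt0 exprn_even_gt0//= lt_eqF//; lra.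
have dTpos z : 0 < P1 z - P0 z -> 0 < W z -> 0 < dT z.
  by move=> D w; rewrite /dT pmulr_lgt0// invr_gt0 exprn_even_gt0//= lt_eqF//; lra.
have T1 z : P1 z = 0 -> 0 < P1 z - P0 z -> T z = 1.
  by move=> P1z D; rewrite /T P1z subr0 divff// lt_eqF//; lra.
have T0 z : P0 z = 0 -> T z = 0 by move=> P0z; rewrite /T P0z mul0r.
have oc (a b z : R) : z \in `]a, b[ -> a < z < b /\ a <= z <= b.
  by rewrite in_itv/= => /andP[h1 h2]; rewrite h1 h2 !ltW.
have [X1 [F1 [XP1 cF1 dF1 FE1]]] : exists X Phi : R -> R,
  [/\ (forall t, 0 < t < 1 -> (X t \in `]x1, x2[) /\ T (X t) = t),
      {within `[0, 1], continuous Phi},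
      (forall t, 0 < t < 1 -> is_derive t 1 Phi (g (X t) / dT (X t)))
    & Phi 1 - Phi 0 = - (\int[mu]_(x in `[x1, x2]) g x)%R].
  have Ta : T x1 = 1 by apply: T1; [rewrite /P1 /cub subrr !mul0r|apply: D1; rewrite lexx ltW].
  have Tb : T x2 = 0 by apply: T0; rewrite /P0 /cub subrr !mul0r.
  have dd z : z \in `]x1, x2[ -> is_derive z 1 T (dT z).
    by move=> /oc[_ /D1]; exact: dTD.
  have ds z : z \in `]x1, x2[ -> dT z < 0.
    by move=> /oc[/W1 ? /D1]; move/dTneg; apply.
  exact (@decreasing_branch _ _ _ T dT g x12 (cTD _ _ D1) Ta Tb dd ds i1 c1).
have [X2 [F2 [XP2 cF2 dF2 FE2]]] : exists X Phi : R -> R,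
  [/\ (forall t, 0 < t < 1 -> (X t \in `]x3, x4[) /\ T (X t) = t),
      {within `[0, 1], continuous Phi},
      (forall t, 0 < t < 1 -> is_derive t 1 Phi (g (X t) / dT (X t)))
    & Phi 1 - Phi 0 = (\int[mu]_(x in `[x3, x4]) g x)%R].
  have Ta : T x3 = 0 by apply: T0; rewrite /P0 /cub subrr mulr0 mul0r.
  have Tb : T x4 = 1 by apply: T1; [rewrite /P1 /cub subrr mulr0 mul0r|apply: D2; rewrite lexx ltW].
  have dd z : z \in `]x3, x4[ -> is_derive z 1 T (dT z).
    by move=> /oc[_ /D2]; exact: dTD.
  have ds z : z \in `]x3, x4[ -> 0 < dT z.
    by move=> /oc[/W2 ? /D2]; move/dTpos; apply.
  exact (@increasing_branch _ _ _ T dT g x34 (cTD _ _ D2) Ta Tb dd ds i2 c2).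
have [X3 [F3 [XP3 cF3 dF3 FE3]]] : exists X Phi : R -> R,
  [/\ (forall t, 0 < t < 1 -> (X t \in `]x5, x6[) /\ T (X t) = t),
      {within `[0, 1], continuous Phi},
      (forall t, 0 < t < 1 -> is_derive t 1 Phi (g (X t) / dT (X t)))
    & Phi 1 - Phi 0 = - (\int[mu]_(x in `[x5, x6]) g x)%R].
  have Ta : T x5 = 1 by apply: T1; [rewrite /P1 /cub subrr mulr0|apply: D3; rewrite lexx ltW].
  have Tb : T x6 = 0 by apply: T0; rewrite /P0 /cub subrr mulr0.
  have dd z : z \in `]x5, x6[ -> is_derive z 1 T (dT z).
    by move=> /oc[_ /D3]; exact: dTD.
  have ds z : z \in `]x5, x6[ -> dT z < 0.
    by move=> /oc[/W3 ? /D3]; move/dTneg; apply.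
  exact (@decreasing_branch _ _ _ T dT g x56 (cTD _ _ D3) Ta Tb dd ds i3 c3).
(* This substitution absorbs the factor 1 / sqrt(t (1 - t)), as [u (1 - u) = (sin / 2)^2]. *)
pose u (th : R) : R := (1 - cos th) / 2.
pose dC t z := t * dP1 z + (1 - t) * dP0 z.
have uE th : u th * (1 - u th) = (sin th / 2) ^+ 2.
  by rewrite exprMn sin2cos2 /u; field.
have sin_pos th : 0 < th < pi -> 0 < sin th by move=> ?; exact: sin_gt0_pi.
have uoo th : 0 < th < pi -> 0 < u th < 1.
  move=> /sin_pos s0; have : 0 < u th * (1 - u th).
    by rewrite uE exprn_even_gt0//= gt_eqF//; lra.
  have := cos_le1 th; have := cos_geN1 th => cm1 cl1 upos.
  have [uz|uz] := eqVneq (u th) 0; first by move: upos; rewrite uz mul0r ltxx.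
  have [uz1|uz1] := eqVneq (u th) 1; first by move: upos; rewrite uz1 subrr mulr0 ltxx.
  have ug0 : 0 <= u th by rewrite /u; lra.
  have ul1 : u th <= 1 by rewrite /u; lra.
  by rewrite lt0r uz ug0 lt_neqAle uz1 ul1.
(* At a root of C_t, with D = P1 - P0, one has P0 = - t D and P1 = (1 - t) D; hence - P0 P1 = t (1 -
   t) D^2 and W = - D C_t', so D cancels. *)
have key th z : 0 < th < pi -> T z = u th -> 0 < P1 z - P0 z -> W z != 0 ->
    (N z / Num.sqrt (- P z)) / dT z * (sin th / 2) = - (N z / dC (u th) z).
  move=> /sin_pos s0 Tz D0 W0; set D := P1 z - P0 z in D0.
  have P0E : P0 z = - u th * D.
    by rewrite -Tz /T /D; field; rewrite subr_eq0 -subr_eq0 lt_eqF//; move: D0; rewrite /D; lra.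
  have P1E : P1 z = (1 - u th) * D.
    have -> : P1 z = P0 z + D by rewrite /D addrC subrK.
    by rewrite P0E; ring.
  have WE : W z = - D * dC (u th) z.
    by rewrite /W /wronskian_cub -/P0 -/P1 -/dP0 -/dP1 P0E P1E /dC; ring.
  have -> : Num.sqrt (- P z) = sin th / 2 * D.
    have -> : - P z = (sin th / 2 * D) ^+ 2.
      by rewrite /P -/P0 -/P1 P0E P1E exprMn -uE; ring.
    by rewrite sqrtr_sqr ger0_norm// mulr_ge0 ?(ltW D0)//; lra.
  have -> : dT z = - dC (u th) z / D.
    rewrite /dT WE; have -> : P0 z - P1 z = - D by rewrite /D; ring.
    by field; rewrite gt_eqF.
  have dC0 : dC (u th) z != 0.
    by move: W0; rewrite WE mulf_eq0 negb_or => /andP[].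
  by field; rewrite dC0 !gt_eqF.
have Csum t : 0 < t < 1 ->
    N (X1 t) / dC t (X1 t) + N (X2 t) / dC t (X2 t) + N (X3 t) / dC t (X3 t) = 1.
  move=> t01; have [I1 T1t] := XP1 _ t01; have [I2 T2t] := XP2 _ t01.
  have [I3 T3t] := XP3 _ t01.
  pose a := - (t * (x1 + x4 + x5) + (1 - t) * (x2 + x3 + x6)).
  pose b := t * (x1 * x4 + x1 * x5 + x4 * x5)
    + (1 - t) * (x2 * x3 + x2 * x6 + x3 * x6).
  pose c := - (t * (x1 * x4 * x5) + (1 - t) * (x2 * x3 * x6)).
  have C0 z : 0 < P1 z - P0 z -> T z = t -> z ^+ 3 + a * z ^+ 2 + b * z + c = 0.
    move=> D0 Tz; have -> : z ^+ 3 + a * z ^+ 2 + b * z + c = t * P1 z + (1 - t) * P0 z.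
      by rewrite /a /b /c /P0 /P1 /cub; ring.
    rewrite -Tz /T; field; rewrite lt_eqF//; move: D0; lra.
  have dCE z : dC t z = 3 * z ^+ 2 + 2 * a * z + b.
    by rewrite /dC /a /b /dP0 /dP1 /dcub; ring.
  have NE z : N z = z ^+ 2 + (- (r1 + r2)) * z + r1 * r2 by rewrite /N; ring.
  rewrite !dCE !NE.
  have C1 := C0 _ (D1 _ (oc _ _ _ I1).2) T1t.
  have C2 := C0 _ (D2 _ (oc _ _ _ I2).2) T2t.
  have C3 := C0 _ (D3 _ (oc _ _ _ I3).2) T3t.
  move: I1 I2 I3; rewrite !in_itv/= => /andP[? ?] /andP[? ?] /andP[? ?].
  by apply: sum_quad_over_cubic_derive C1 C2 C3; rewrite lt_eqF//; lra.
(* The middle branch runs in the opposite direction, so with this sign every term contributes minus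
   its integral to [Psi pi - Psi 0]. *)
pose Psi th := F1 (u th) - F2 (u th) + F3 (u th).
have dPsi th : 0 < th < pi -> is_derive th 1 Psi (- 1).
  move=> thp; have u01 := uoo _ thp.
  have du : is_derive th 1 u (sin th / 2).
    have dc := @is_deriveB _ _ _ _ _ th 1 _ _ (is_derive_cst (1 : R) th 1) (is_derive_cos th).
    have dz := @is_deriveZ _ _ _ _ (2^-1) th 1 _ dc.
    rewrite (_ : u = 2^-1 \*: (cst 1 - cos)); last first.
      by apply/funext => y; rewrite /u /= mulrC.
    by apply: (is_derive_eq dz); rewrite sub0r opprK /GRing.scale /= mulrC.
  have d1 := @is_derive1_comp _ F1 u th _ _ (dF1 _ u01) du.
  have d2 := @is_derive1_comp _ F2 u th _ _ (dF2 _ u01) du.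
  have d3 := @is_derive1_comp _ F3 u th _ _ (dF3 _ u01) du.
  have d12 := @is_deriveB _ _ _ _ _ th 1 _ _ d1 d2.
  have d123 := @is_deriveD _ _ _ _ _ th 1 _ _ d12 d3.
  apply: (@is_derive_eq _ _ _ Psi _ _ _ _ d123).
  have [I1 T1t] := XP1 _ u01; have [I2 T2t] := XP2 _ u01.
  have [I3 T3t] := XP3 _ u01.
  have [J1 K1] := oc _ _ _ I1; have [J2 K2] := oc _ _ _ I2.
  have [J3 K3] := oc _ _ _ I3.
  rewrite (g1 _ I1) (g2 _ I2) (g3 _ I3) !mulNr opprK.
  have n1 : W (X1 (u th)) != 0 by rewrite lt_eqF// W1.
  have n2 : W (X2 (u th)) != 0 by rewrite gt_eqF// W2.
  have n3 : W (X3 (u th)) != 0 by rewrite lt_eqF// W3.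
  rewrite (key _ _ thp T1t (D1 _ K1) n1) (key _ _ thp T2t (D2 _ K2) n2).
  rewrite (key _ _ thp T3t (D3 _ K3) n3).
  by rewrite -!opprD Csum.
have cu A : {within A, continuous u}.
  apply: continuous_subspaceT => y; apply: cvgM; last exact: cvg_cst.
  by apply: cvgB; [exact: cvg_cst|exact: continuous_cos].
have u01 th : `[0, pi]%classic th -> `[0 : R, 1]%classic (u th).
  move=> _ /=; rewrite in_itv/= /u; have := cos_le1 th; have := cos_geN1 th.
  by move=> ? ?; apply/andP; split; lra.
have cPsi : {within `[0, pi], continuous Psi}.
  have k1 := within_continuous_comp_in u01 (cu _) cF1.
  have k2 := within_continuous_comp_in u01 (cu _) cF2.
  have k3 := within_continuous_comp_in u01 (cu _) cF3.
  by move=> y; apply: cvgD; [apply: cvgB; [exact: k1|exact: k2]|exact: k3].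
have u0 : u 0 = 0 by rewrite /u cos0 subrr mul0r.
have upi : u pi = 1 by rewrite /u cospi opprK -[1 + 1]/(2) divff.
have dPsi' th : th \in `]0, pi[ -> is_derive th 1 Psi ((fun=> - 1) th).
  by rewrite in_itv/= => /dPsi.
have [th _] := MVT (pi_gt0 R) dPsi' cPsi.
by rewrite /Psi /= u0 upi; lra.
Qed.

End six_points.

(** * The sum of the three actions *)

Section sum_wint.
Context {R : realType}.
Notation mu := (@lebesgue_measure R).
Implicit Types (a b e r s : R).

(** The integrand p without its constant factor sqrt(2h) / 2. *)
Definition density e1 e2 e3 e4 r1 r2 s :=
  Num.sqrt (- ((s - r1) * (s - r2)) / Apol e1 e2 e3 e4 s).

Lemma density_weight e1 e2 e3 e4 sg r1 r2 s : sg ^+ 2 = 1 ->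
  sg * Apol e1 e2 e3 e4 s <= 0 ->
  density e1 e2 e3 e4 r1 r2 s =
  Num.sqrt (sg * ((s - r1) * (s - r2))) * weight e1 e2 e3 e4 s.
Proof.
move=> sg2; rewrite /density /weight; move: (Apol e1 e2 e3 e4 s) => A sgA.
have sgn : `|sg| = 1 by apply/eqP; rewrite -(@eqrXn2 _ 2)// expr1n real_normK ?num_real// sg2.
have -> : `|A| = - (sg * A).
  by rewrite -(ler0_norm sgA) normrM sgn mul1r.
have sg0 : sg != 0 by apply/eqP => z; move: sg2; rewrite z expr0n/= => /esym/eqP; rewrite oner_eq0.
have sgV : sg^-1 = sg by apply: (mulfI sg0); rewrite divff// -expr2 sg2.
rewrite [RHS]mulrC -sqrtrM; last by rewrite invr_ge0 oppr_ge0.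
by congr Num.sqrt; rewrite invrN invfM sgV -[LHS]mul1r -sg2; ring.
Qed.

Lemma Apol_sign e1 e2 e3 e4 s : e1 < e2 -> e2 < e3 -> e3 < e4 ->
  [/\ e1 <= s <= e2 -> 1 * Apol e1 e2 e3 e4 s <= 0,
      e2 <= s <= e3 -> -1 * Apol e1 e2 e3 e4 s <= 0
    & e3 <= s <= e4 -> 1 * Apol e1 e2 e3 e4 s <= 0].
Proof.
move=> e12 e23 e34.
have pos (x y z t : R) : 0 <= x -> 0 <= y -> 0 <= z -> 0 <= t -> - (x * y * z * t) <= 0.
  by move=> *; rewrite oppr_le0 !mulr_ge0.
split=> /andP[? ?]; rewrite /Apol.
- rewrite (_ : _ * _ = - ((s - e1) * (e2 - s) * (e3 - s) * (e4 - s))); last by ring.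
  by apply: pos; lra.
- rewrite (_ : _ * _ = - ((s - e1) * (s - e2) * (e3 - s) * (e4 - s))); last by ring.
  by apply: pos; lra.
- rewrite (_ : _ * _ = - ((s - e1) * (s - e2) * (s - e3) * (e4 - s))); last by ring.
  by apply: pos; lra.
Qed.

Lemma eq_Rintegral_itv a b a' b' (f g : R -> R) :
  a <= a' -> b' <= b -> (forall s : R, a' <= s <= b' -> f s = g s) ->
  (forall s : R, a <= s <= b -> ~~ (a' <= s <= b') -> g s = 0) ->
  (\int[mu]_(s in `[a', b']) f s)%R = (\int[mu]_(s in `[a, b]) g s)%R.
Proof.
move=> aa bb fg g0; rewrite Rintegral_mkcond [RHS]Rintegral_mkcond.
congr (Rintegral _ _ _); apply/funext => s; rewrite !patchE.
rewrite !mem_setE !in_itv/=.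
have [sin|sout] := boolP (a' <= s <= b').
  have -> : a <= s <= b by move/andP: sin => [? ?]; apply/andP; split; lra.
  exact: fg.
by case: ifPn => // sab; rewrite g0.
Qed.

(** Past [r1] but before [e2 <= r2] the product (s - r1)(s - r2) is nonpositive, so clipping makes
    the added part of the gap contribute 0. The other two gaps use [r1 <= r2] and [r1 <= e3] in the
    same way. *)
Lemma density_integral1 e1 e2 e3 e4 r1 r2 : e1 < e2 -> e2 < e3 -> e3 < e4 ->
  root_domain e1 e2 e3 e4 r1 r2 ->
  (\int[mu]_(s in `[e1, Num.min r1 e2]) density e1 e2 e3 e4 r1 r2 s)%R =
  wint e1 e2 e3 e4 1 e1 e2 r1 r2.
Proof.
move=> e12 e23 e34 [h1 h2 h3 h4 h5].
apply: eq_Rintegral_itv; rewrite ?ge_min ?lexx ?orbT//.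
  move=> s /andP[s1]; rewrite le_min => /andP[s2 s3].
  apply: density_weight; first by rewrite expr1n.
  by have [+ _ _] := @Apol_sign e1 e2 e3 e4 s e12 e23 e34; apply; rewrite s1.
move=> s /andP[s1 s2]; rewrite s1 /= le_min s2 andbT -ltNge => rs.
rewrite ler0_sqrtr ?mul0r// mul1r.
by rewrite -oppr_ge0 -mulrN mulr_ge0//; lra.
Qed.

Lemma density_integral2 e1 e2 e3 e4 r1 r2 : e1 < e2 -> e2 < e3 -> e3 < e4 ->
  root_domain e1 e2 e3 e4 r1 r2 ->
  (\int[mu]_(s in `[Num.max r1 e2, Num.min r2 e3]) density e1 e2 e3 e4 r1 r2 s)%R =
  wint e1 e2 e3 e4 (-1) e2 e3 r1 r2.
Proof.
move=> e12 e23 e34 [h1 h2 h3 h4 h5].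
apply: eq_Rintegral_itv; rewrite ?ge_min ?le_max ?lexx ?orbT//.
  move=> s; rewrite ge_max le_min => /andP[/andP[s1 s2] /andP[s3 s4]].
  apply: density_weight; first by rewrite sqrrN expr1n.
  by have [_ + _] := @Apol_sign e1 e2 e3 e4 s e12 e23 e34; apply; rewrite s2.
move=> s /andP[s1 s2]; rewrite ge_max le_min s1 s2 !andbT negb_and -!ltNge => rs.
rewrite ler0_sqrtr ?mul0r// mulN1r oppr_le0.
case/orP: rs => rs; last by rewrite mulr_ge0//; lra.
by rewrite -mulrNN mulr_ge0//; lra.
Qed.

Lemma density_integral3 e1 e2 e3 e4 r1 r2 : e1 < e2 -> e2 < e3 -> e3 < e4 ->
  root_domain e1 e2 e3 e4 r1 r2 ->
  (\int[mu]_(s in `[Num.max r2 e3, e4]) density e1 e2 e3 e4 r1 r2 s)%R =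
  wint e1 e2 e3 e4 1 e3 e4 r1 r2.
Proof.
move=> e12 e23 e34 [h1 h2 h3 h4 h5].
apply: eq_Rintegral_itv; rewrite ?le_max ?lexx ?orbT//.
  move=> s; rewrite ge_max => /andP[/andP[s1 s2] s3].
  apply: density_weight; first by rewrite expr1n.
  by have [_ _ +] := @Apol_sign e1 e2 e3 e4 s e12 e23 e34; apply; rewrite s2.
move=> s /andP[s1 s2]; rewrite ge_max s1 s2 !andbT -ltNge => rs.
rewrite ler0_sqrtr ?mul0r// mul1r.
by rewrite -oppr_ge0 -mulrN mulr_ge0//; lra.
Qed.

Lemma free_of_nodes_itvs e1 e2 e3 e4 : e1 < e2 -> e2 < e3 -> e3 < e4 ->
  [/\ free_of_nodes e1 e2 e3 e4 e1 e2, free_of_nodes e1 e2 e3 e4 e2 e3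
    & free_of_nodes e1 e2 e3 e4 e3 e4].
Proof.
move=> e12 e23 e34; rewrite /free_of_nodes /= !lexx ?orbT ?andbT /=.
have h13 := lt_trans e12 e23; have h24 := lt_trans e23 e34.
by rewrite !(ltW e12) !(ltW e23) !(ltW e34) !(ltW h13) !(ltW h24) ?orbT.
Qed.

Lemma continuous_density e1 e2 e3 e4 r1 r2 s : Apol e1 e2 e3 e4 s != 0 ->
  {for s, continuous (density e1 e2 e3 e4 r1 r2)}.
Proof.
move=> A0; have c e : continuous (fun s => s - e).
  by move=> x; apply: cvgB; [exact: cvg_id|exact: cvg_cst].
apply: (@continuous_comp _ _ _ (fun s => - ((s - r1) * (s - r2)) / Apol e1 e2 e3 e4 s)).
  apply: cvgM; first by apply: cvgN; apply: cvgM; exact: c.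
  by apply: cvgV => //; exact: continuous_Apol.
exact: sqrt_continuous.
Qed.

Lemma densityE e1 e2 e3 e4 r1 r2 s :
  (s - r1) * (s - r2) * Apol e1 e2 e3 e4 s < 0 ->
  density e1 e2 e3 e4 r1 r2 s = `|(s - r1) * (s - r2)| /
    Num.sqrt (- ((s - r1) * (s - r2) * Apol e1 e2 e3 e4 s)).
Proof.
rewrite /density; set N := (s - r1) * (s - r2); set A := Apol _ _ _ _ _ => NA.
have : N * A != 0 by rewrite lt_eqF.
rewrite mulf_eq0 negb_or => /andP[N0 A0].
have -> : - N / A = N ^+ 2 * (- (N * A))^-1 by field; rewrite N0 A0.
by rewrite sqrtrM ?sqr_ge0// sqrtr_sqr sqrtrV// oppr_ge0 ltW.
Qed.

Lemma integrable_density e1 e2 e3 e4 sg a b a' b' r1 r2 :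
  e1 < e2 -> e2 < e3 -> e3 < e4 -> free_of_nodes e1 e2 e3 e4 a b ->
  sg ^+ 2 = 1 -> (forall s, a <= s <= b -> sg * Apol e1 e2 e3 e4 s <= 0) ->
  a <= a' -> b' <= b ->
  mu.-integrable `[a', b'] (EFin \o density e1 e2 e3 e4 r1 r2).
Proof.
move=> e12 e23 e34 fr sg2 sA aa bb.
have mab : measurable (`[a, b]%classic : set (measurableTypeR R)) by [].
apply: (integrableS mab) => //.
  by move=> s /=; rewrite !in_itv/= => /andP[? ?]; apply/andP; split; lra.
have iw := integrable_wint sg r1 r2 e12 e23 e34 fr.
apply: (eq_integrable mab _ _ _ iw) => s.
rewrite inE/= in_itv/= => sab; congr EFin; apply/esym; apply: density_weight => //.
exact: sA.
Qed.

Lemma sum_wint_generic e1 e2 e3 e4 r1 r2 : e1 < e2 -> e2 < e3 -> e3 < e4 ->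
  e1 < r1 -> r1 < e3 -> r1 != e2 -> e2 < r2 -> r2 < e4 -> r2 != e3 -> r1 < r2 ->
  wint e1 e2 e3 e4 1 e1 e2 r1 r2 + wint e1 e2 e3 e4 (-1) e2 e3 r1 r2 +
  wint e1 e2 e3 e4 1 e3 e4 r1 r2 = pi.
Proof.
move=> e12 e23 e34 h1 h2 h3 h4 h5 h6 h7.
have D : root_domain e1 e2 e3 e4 r1 r2 by split; exact: ltW.
have [f1 f2 f3] := free_of_nodes_itvs e12 e23 e34.
rewrite -density_integral1// -density_integral2// -density_integral3//.
have [x2l x2m] : Num.min r1 e2 <= r1 /\ Num.min r1 e2 <= e2.
  by rewrite !ge_min !lexx orbT.
have [x3l x3m] : r1 <= Num.max r1 e2 /\ e2 <= Num.max r1 e2.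
  by rewrite !le_max !lexx orbT.
have [x4l x4m] : Num.min r2 e3 <= r2 /\ Num.min r2 e3 <= e3.
  by rewrite !ge_min !lexx orbT.
have [x5l x5m] : r2 <= Num.max r2 e3 /\ e3 <= Num.max r2 e3.
  by rewrite !le_max !lexx orbT.
have x12 : e1 < Num.min r1 e2 by rewrite lt_min h1.
have x23 : Num.min r1 e2 < Num.max r1 e2.
  by rewrite gt_min !lt_max !ltxx/= orbF -neq_lt.
have x34 : Num.max r1 e2 < Num.min r2 e3 by rewrite gt_max !lt_min h7 h2 h4.
have x45 : Num.min r2 e3 < Num.max r2 e3.
  by rewrite gt_min !lt_max !ltxx/= orbF -neq_lt.
have x56 : Num.max r2 e3 < e4 by rewrite gt_max h5.
have mm (u v z : R) : (z - Num.min u v) * (z - Num.max u v) = (z - u) * (z - v).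
  by have [uv|uv] := leP u v; rewrite // mulrC.
(* Products over a min/max pair ignore its order, so the four relative positions of [r1], [e2] and
   [r2], [e3] are treated at once. *)
have PE z : cub (Num.min r1 e2) (Num.max r1 e2) e4 z *
    cub e1 (Num.min r2 e3) (Num.max r2 e3) z =
    (z - r1) * (z - r2) * Apol e1 e2 e3 e4 z.
  transitivity ((z - Num.min r1 e2) * (z - Num.max r1 e2) *
     ((z - Num.min r2 e3) * (z - Num.max r2 e3)) * ((z - e1) * (z - e4))).
    by rewrite /cub; ring.
  by rewrite !mm /Apol; ring.
have lt0 (x y z : R) : 0 < x -> 0 < y -> z = - (x * y) -> z < 0.
  by move=> x0 y0 ->; rewrite oppr_lt0 mulr_gt0.
apply: (@six_points_integral _ _ _ _ _ _ _ r1 r2) => //.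
- apply: (@integrable_density e1 e2 e3 e4 1 e1 e2) => //; first by rewrite expr1n.
  by move=> s; have [+ _ _] := @Apol_sign e1 e2 e3 e4 s e12 e23 e34.
- apply: (@integrable_density e1 e2 e3 e4 (-1) e2 e3) => //; first by rewrite sqrrN expr1n.
  by move=> s; have [_ + _] := @Apol_sign e1 e2 e3 e4 s e12 e23 e34.
- apply: (@integrable_density e1 e2 e3 e4 1 e3 e4) => //; first by rewrite expr1n.
  by move=> s; have [_ _ +] := @Apol_sign e1 e2 e3 e4 s e12 e23 e34.
- move=> x; rewrite in_itv/= => /andP[? ?]; apply: continuous_density.
  by rewrite Apol_neq0; apply/and4P; split; (rewrite gt_eqF//; lra) || (rewrite lt_eqF//; lra).
- move=> x; rewrite in_itv/= => /andP[? ?]; apply: continuous_density.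
  by rewrite Apol_neq0; apply/and4P; split; (rewrite gt_eqF//; lra) || (rewrite lt_eqF//; lra).
- move=> x; rewrite in_itv/= => /andP[? ?]; apply: continuous_density.
  by rewrite Apol_neq0; apply/and4P; split; (rewrite gt_eqF//; lra) || (rewrite lt_eqF//; lra).
- move=> x; rewrite in_itv/= => /andP[? ?]; rewrite PE.
  have N0 : 0 < (x - r1) * (x - r2) by rewrite -mulrNN mulr_gt0//; lra.
  have A0 : 0 < (x - e1) * (e2 - x) * (e3 - x) * (e4 - x) by rewrite !mulr_gt0//; lra.
  rewrite densityE; first by rewrite gtr0_norm.
  by apply: (lt0 _ _ _ N0 A0); rewrite /Apol; ring.
- move=> x; rewrite in_itv/= => /andP[? ?]; rewrite PE.
  have N0 : 0 < (x - r1) * (r2 - x) by rewrite mulr_gt0//; lra.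
  have A0 : 0 < (x - e1) * (x - e2) * (e3 - x) * (e4 - x) by rewrite !mulr_gt0//; lra.
  rewrite densityE; first by rewrite ltr0_norm//
    (_ : _ * _ = - ((x - r1) * (r2 - x))) ?oppr_lt0//; ring.
  by apply: (lt0 _ _ _ N0 A0); rewrite /Apol; ring.
- move=> x; rewrite in_itv/= => /andP[? ?]; rewrite PE.
  have N0 : 0 < (x - r1) * (x - r2) by rewrite mulr_gt0//; lra.
  have A0 : 0 < (x - e1) * (x - e2) * (x - e3) * (e4 - x) by rewrite !mulr_gt0//; lra.
  rewrite densityE; first by rewrite gtr0_norm.
  by apply: (lt0 _ _ _ N0 A0); rewrite /Apol; ring.
Qed.

Lemma convex_comb_gt0 (x y c t : R) : 0 < t -> t < 1 -> 0 <= x -> 0 < c ->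
  y = (1 - t) * x + t * c -> 0 < y.
Proof.
move=> t0 t1 x0 c0 ->; apply: ltr_wpDl; last exact: mulr_gt0.
by apply: mulr_ge0 => //; lra.
Qed.

(* Boundary and coincident configurations are limits of generic ones. *)
Lemma sum_wint e1 e2 e3 e4 r1 r2 : e1 < e2 -> e2 < e3 -> e3 < e4 ->
  root_domain e1 e2 e3 e4 r1 r2 ->
  wint e1 e2 e3 e4 1 e1 e2 r1 r2 + wint e1 e2 e3 e4 (-1) e2 e3 r1 r2 +
  wint e1 e2 e3 e4 1 e3 e4 r1 r2 = pi.
Proof.
move=> e12 e23 e34 [h1 h2 h3 h4 h5].
have [fr1 fr2 fr3] := free_of_nodes_itvs e12 e23 e34.
(* A generic pair strictly inside the convex root domain; moving towards it makes all inequalities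
   strict at once and leaves the nodes [e2], [e3]. *)
pose c1 := (e1 + e2) / 2; pose c2 := (e3 + e4) / 2.
pose f1 t := r1 + t * (c1 - r1); pose f2 t := r2 + t * (c2 - r2).
have cf (r c : R) : r + t * (c - r) @[t --> 0^'+] --> r.
  have H : (fun t : R => r + t * (c - r)) @ 0 --> r + 0 * (c - r).
    apply: cvgD; first exact: cvg_cst.
    by apply: cvgM; [exact: cvg_id|exact: cvg_cst].
  by rewrite mul0r addr0 in H; exact: cvg_at_right_filter.
have cf1 : f1 @ 0^'+ --> r1 by exact: cf.
have cf2 : f2 @ 0^'+ --> r2 by exact: cf.
pose S s1 s2 := wint e1 e2 e3 e4 1 e1 e2 s1 s2 + wint e1 e2 e3 e4 (-1) e2 e3 s1 s2 +
  wint e1 e2 e3 e4 1 e3 e4 s1 s2.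
have cS : S (f1 t) (f2 t) @[t --> 0^'+] --> S r1 r2.
  by apply: cvgD; [apply: cvgD|]; exact: cvg_wint.
have off (r c e : R) : c != e -> \forall t \near 0^'+, r + t * (c - r) != e.
  move=> ce; have [re|re] := eqVneq r e.
    near=> t; rewrite re -subr_eq0 addrAC subrr add0r mulf_neq0 ?subr_eq0//.
  have H : r + t * (c - r) - e @[t --> 0^'+] --> r - e.
    by apply: cvgB; [exact: cf|exact: cvg_cst].
  have re0 : r - e != 0 by rewrite subr_eq0.
  near=> t; rewrite -subr_eq0; near: t; exact: cvgr_neq0 H re0.
have c1e : c1 != e2 by rewrite lt_eqF// /c1; lra.
have c2e : c2 != e3 by rewrite gt_eqF// /c2; lra.
have cpi : S (f1 t) (f2 t) @[t --> 0^'+] --> (pi : R).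
  apply: cvg_near_cst; near=> t.
  have t0 : 0 < t by [].
  have t1 : t < 1 by near: t; exact: nbhs_right_lt.
  rewrite /S; apply: sum_wint_generic => //.
  - by rewrite -subr_gt0; apply: (@convex_comb_gt0 (r1 - e1) _ (c1 - e1) t) => //;
      rewrite /f1 ?/c1; [lra|lra|ring].
  - by rewrite -subr_gt0; apply: (@convex_comb_gt0 (e3 - r1) _ (e3 - c1) t) => //;
      rewrite /f1 ?/c1; [lra|lra|ring].
  - by near: t; exact: off.
  - by rewrite -subr_gt0; apply: (@convex_comb_gt0 (r2 - e2) _ (c2 - e2) t) => //;
      rewrite /f2 ?/c2; [lra|lra|ring].
  - by rewrite -subr_gt0; apply: (@convex_comb_gt0 (e4 - r2) _ (e4 - c2) t) => //;
      rewrite /f2 ?/c2; [lra|lra|ring].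
  - by near: t; exact: off.
  - by rewrite -subr_gt0; apply: (@convex_comb_gt0 (r2 - r1) _ (c2 - c1) t) => //;
      rewrite /f1 /f2 ?/c1 ?/c2; [lra|lra|ring].
exact: (cvg_unique (@Rhausdorff R) cS cpi).
Unshelve. all: by end_near. Qed.

End sum_wint.

(** * Surjectivity onto the triangle *)

Section surjectivity.
Context {R : realType}.
Notation mu := (@lebesgue_measure R).
Implicit Types (a b e r s h : R).

Lemma wint_ge0 e1 e2 e3 e4 sg a b r1 r2 : 0 <= wint e1 e2 e3 e4 sg a b r1 r2.
Proof. by apply: Rintegral_ge0 => s _; rewrite mulr_ge0 ?sqrtr_ge0. Qed.

Lemma wint_eq0 e1 e2 e3 e4 sg a b r1 r2 :
  (forall s, a <= s <= b -> sg * ((s - r1) * (s - r2)) <= 0) ->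
  wint e1 e2 e3 e4 sg a b r1 r2 = 0.
Proof.
move=> H; rewrite /wint (@eq_Rintegral _ _ _ _ _ (cst 0)).
  by rewrite Rintegral_cst// mul0r.
by move=> s; rewrite inE/= in_itv/= => /H H0; rewrite ler0_sqrtr// mul0r.
Qed.

(** For [s <= r1] both factors [r1 - s] and [r2 - s] are nonnegative and grow with the roots; for
    [s > r1] the smaller integrand is clipped to 0. *)
Lemma wint1_mono e1 e2 e3 e4 r1 r2 r1' r2' : e1 < e2 -> e2 < e3 -> e3 < e4 ->
  e2 <= r2 -> r1 <= r1' -> r2 <= r2' ->
  wint e1 e2 e3 e4 1 e1 e2 r1 r2 <= wint e1 e2 e3 e4 1 e1 e2 r1' r2'.
Proof.
move=> e12 e23 e34 h2 h11 h22; have [f1 _ _] := free_of_nodes_itvs e12 e23 e34.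
apply: le_wint => // s; rewrite in_itv/= !mul1r => /andP[s1 s2].
have [rs|rs] := leP s r1.
  apply: ler_wsqrtr; rewrite -mulrNN -[leRHS]mulrNN.
  by apply: ler_pM; lra.
rewrite ler0_sqrtr ?sqrtr_ge0//.
by rewrite -oppr_ge0 -mulrN mulr_ge0//; lra.
Qed.

Lemma wint3_anti e1 e2 e3 e4 r1 r2 r1' r2' : e1 < e2 -> e2 < e3 -> e3 < e4 ->
  r1' <= e3 -> r1 <= r1' -> r2 <= r2' ->
  wint e1 e2 e3 e4 1 e3 e4 r1' r2' <= wint e1 e2 e3 e4 1 e3 e4 r1 r2.
Proof.
move=> e12 e23 e34 h2 h11 h22; have [_ _ f3] := free_of_nodes_itvs e12 e23 e34.
apply: le_wint => // s; rewrite in_itv/= !mul1r => /andP[s1 s2].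
have [rs|rs] := leP r2' s.
  by apply: ler_wsqrtr; apply: ler_pM; lra.
rewrite ler0_sqrtr ?sqrtr_ge0//.
by rewrite -oppr_ge0 -mulrN mulr_ge0//; lra.
Qed.

(* Among the points with K1 >= k1 and K3 >= k3, a nonempty set because of the
   curve K2 = 0, the one with least r1 and greatest r2 gives equality: K1 is
   increasing and K3 decreasing in both roots. *)
Lemma wint_surjective e1 e2 e3 e4 k1 k3 : e1 < e2 -> e2 < e3 -> e3 < e4 ->
  0 <= k1 -> 0 <= k3 -> k1 + k3 <= pi ->
  exists r1 r2, [/\ root_domain e1 e2 e3 e4 r1 r2,
    wint e1 e2 e3 e4 1 e1 e2 r1 r2 = k1 & wint e1 e2 e3 e4 1 e3 e4 r1 r2 = k3].
Proof.
move=> e12 e23 e34 k10 k30 k13.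
have [fr1 fr2 fr3] := free_of_nodes_itvs e12 e23 e34.
pose K1 := wint e1 e2 e3 e4 1 e1 e2; pose K2 := wint e1 e2 e3 e4 (-1) e2 e3.
pose K3 := wint e1 e2 e3 e4 1 e3 e4; pose D := root_domain e1 e2 e3 e4.
have Ksum r1 r2 : D r1 r2 -> K1 r1 r2 + K2 r1 r2 + K3 r1 r2 = pi.
  exact: sum_wint.
have K1_0 r2 : e2 <= r2 -> K1 e1 r2 = 0.
  move=> hr; apply: wint_eq0 => s /andP[? ?]; rewrite mul1r.
  by rewrite -oppr_ge0 -mulrN mulr_ge0//; lra.
have K3_0 r1 : r1 <= e3 -> K3 r1 e4 = 0.
  move=> hr; apply: wint_eq0 => s /andP[? ?]; rewrite mul1r.
  by rewrite -oppr_ge0 -mulrN mulr_ge0//; lra.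
have c1 (r2 x : R) : K1 r r2 @[r --> x] --> K1 x r2.
  by apply: cvg_wint => //; exact: cvg_cst.
have c3 (r1 x : R) : K3 r1 r @[r --> x] --> K3 r1 x.
  by apply: cvg_wint => //; exact: cvg_cst.
pose Om r1 r2 := [/\ D r1 r2, k1 <= K1 r1 r2 & k3 <= K3 r1 r2].
have [a0 [b0 Om0]] : exists a b, Om a b.
  (* The curve K2 = 0: [r2] rests at [e2] until [r1] reaches it, they travel together as a double
     root to [e3], then [r2] goes on alone. Along it K1 runs from 0 to pi, so it takes the value
     [k1], and there K3 = pi - k1 >= k3. *)
  pose p1 (c : R) := Num.min c e3; pose p2 (c : R) := Num.max c e2.
  have Dp c : e1 <= c <= e4 -> D (p1 c) (p2 c).
    move=> /andP[? ?]; rewrite /D /root_domain /p1 /p2.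
    by split; rewrite ?le_min ?ge_min ?le_max ?ge_max ?lexx ?orbT//;
      try (apply/andP; split); lra.
  have K2p c : e1 <= c <= e4 -> K2 (p1 c) (p2 c) = 0.
    move=> /andP[? ?]; apply: wint_eq0 => s /andP[? ?].
    rewrite mulN1r oppr_le0 /p1 /p2.
    have [ce3|ce3] := leP c e3; have [ce2|ce2] := leP c e2.
    - by apply: mulr_ge0; lra.
    - by rewrite -expr2 sqr_ge0.
    - by apply: mulr_ge0; lra.
    - by rewrite -mulrNN; apply: mulr_ge0; lra.
  have cK : {within `[e1, e4], continuous (fun c => K1 (p1 c) (p2 c))}.
    apply: continuous_subspaceT => c; apply: cvg_wint => //.
      exact: (@continuous_min _ _ id (cst e3) c cvg_id (cvg_cst _)).
    exact: (@continuous_max _ _ id (cst e2) c cvg_id (cvg_cst _)).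
  have e14 : e1 <= e4 by lra.
  have v1 : K1 (p1 e1) (p2 e1) = 0.
    rewrite /p1 (min_idPl _); last by lra.
    by apply: K1_0; rewrite le_max lexx orbT.
  have v4 : K1 (p1 e4) (p2 e4) = pi.
    have De4 : e1 <= e4 <= e4 by rewrite e14 lexx.
    rewrite -(Ksum _ _ (Dp _ De4)) (K2p _ De4) /p1 /p2 (min_idPr _); last by lra.
    by rewrite (max_idPl _) ?K3_0//; lra.
  have [|c cin Kc] := @IVT _ _ e1 e4 k1 e14 cK.
    by rewrite v1 v4 ge_min le_max k10/=; apply/orP; right; lra.
  have cin' : e1 <= c <= e4 by move: cin; rewrite in_itv.
  exists (p1 c), (p2 c); split; [exact: Dp|by rewrite Kc|].
  have := Ksum _ _ (Dp _ cin'); rewrite K2p// Kc; lra.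
pose A := [set a | exists b, Om a b]; pose B := [set b | exists a, Om a b].
have A0 : A !=set0 by exists a0, b0.
have B0 : B !=set0 by exists b0, a0.
have lA : has_lbound A by exists e1 => a [b [[]]].
have uB : has_ubound B by exists e4 => b [a [[]]].
have hA : has_inf A by split.
have hB : has_sup B by split.
pose a := inf A; pose b := sup B.
have aA x y : Om x y -> a <= x by move=> O; apply: ge_inf => //; exists y.
have bB x y : Om x y -> y <= b by move=> O; apply: ub_le_sup => //; exists x.
have ae1 : e1 <= a by apply: lb_le_inf => // x [y [[]]].
have be4 : b <= e4 by apply: ge_sup => // x [y [[]]].
have Dxb x y : Om x y -> D x b.
  by move=> O; have := bB _ _ O; case: O => -[*]; split=> //; lra.
have Day x y : Om x y -> D a y.
  by move=> O; have := aA _ _ O; case: O => -[*]; split=> //; lra.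
have Dab : D a b.
  by have := aA _ _ Om0; have := bB _ _ Om0; case: (Om0) => -[*]; split=> //; lra.
(* The infimum and supremum come from possibly different points of [Om]: raising the second root to
   [b] only increases K1, and continuity in the first root then reaches [a]. *)
have Ka : k1 <= K1 a b.
  rewrite leNgt; apply/negP => lt1.
  have : \forall x \near a, K1 x b < k1 by exact: cvgr_lt (c1 b a) _ lt1.
  move=> /nbhs_ballP[d /= d0 dP].
  have [x [y O] xa] := inf_adherent d0 hA.
  have ax := aA _ _ O.
  have : K1 x b < k1.
    by apply: dP; rewrite /ball/= distrC ger0_norm ?subr_ge0//; rewrite -/a in xa; lra.
  have : K1 x y <= K1 x b.
    by have yb := bB _ _ O; case: O => -[*]; apply: wint1_mono.
  by case: O => _ + _; lra.
have Kb : k3 <= K3 a b.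
  rewrite leNgt; apply/negP => lt1.
  have : \forall y \near b, K3 a y < k3 by exact: cvgr_lt (c3 a b) _ lt1.
  move=> /nbhs_ballP[d /= d0 dP].
  have [y [x O] yb] := sup_adherent d0 hB.
  have by_ := bB _ _ O.
  have : K3 a y < k3.
    by apply: dP; rewrite /ball/= ger0_norm ?subr_ge0//; rewrite -/b in yb; lra.
  have : K3 x y <= K3 a y.
    by have xa := aA _ _ O; case: O => -[*]; apply: wint3_anti.
  by case: O => _ _ +; lra.
have [D1 D2 D3 D4 D5] := Dab.
exists a, b; split=> //; apply/eqP; rewrite eq_le; apply/andP; split=> //.
(* With slack in K1 we have [a > e1], and lowering [a] slightly keeps K1 above [k1] while K3 does
   not decrease, against the choice of [a]. *)
- rewrite leNgt; apply/negP => gt1.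
  have ea : e1 < a.
    rewrite lt_neqAle ae1 andbT; apply/eqP => ea.
    by have := K1_0 b D3; rewrite ea => z; move: gt1; rewrite -/(K1 a b) z; lra.
  have : \forall x \near a, k1 < K1 x b by exact: cvgr_gt (c1 b a) _ gt1.
  move=> /nbhs_ballP[d /= d0 dP].
  pose x := Num.max e1 (a - d / 2).
  have xa : x < a by rewrite gt_max ea; lra.
  have xe : e1 <= x by rewrite le_max lexx.
  have xd : a - d / 2 <= x by rewrite le_max lexx orbT.
  have : Om x b.
    split; [by split=> //; lra| |].
    - by apply/ltW/dP; rewrite /ball/= ger0_norm; lra.
    - by apply: (le_trans Kb); apply: wint3_anti => //; exact: ltW.
  by move/aA; lra.
- rewrite leNgt; apply/negP => gt1.
  have be : b < e4.
    rewrite lt_neqAle be4 andbT; apply/eqP => be.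
    by have := K3_0 a D2; rewrite -be => z; move: gt1; rewrite -/(K3 a b) z; lra.
  have : \forall y \near b, k3 < K3 a y by exact: cvgr_gt (c3 a b) _ gt1.
  move=> /nbhs_ballP[d /= d0 dP].
  pose y := Num.min e4 (b + d / 2).
  have yb : b < y by rewrite lt_min be; lra.
  have ye : y <= e4 by rewrite ge_min lexx.
  have yd : y <= b + d / 2 by rewrite ge_min lexx orbT.
  have : Om a y.
    split; [by split=> //; lra| |].
    - by apply: (le_trans Ka); apply: wint1_mono => //; exact: ltW.
    - by apply/ltW/dP; rewrite /ball/= distrC ger0_norm; lra.
  by move/bB; lra.
Qed.

(** The constant is 2/pi times sqrt(2h)/2. The factorisation and the values of the root formulas are
    hypotheses, so that the lemma serves both a given L and an L built from prescribed roots. *)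
Lemma action_map_wint e1 e2 e3 e4 h r1 r2 L :
  e1 < e2 -> e2 < e3 -> e3 < e4 -> 0 < h ->
  root_domain e1 e2 e3 e4 r1 r2 ->
  (forall z, Rpol h (eta1 e1 e2 e3 e4 L) (eta2 e1 e2 e3 e4 L) z =
     2 * h * ((z - r1) * (z - r2))) ->
  Defs.root1 h (eta1 e1 e2 e3 e4 L) (eta2 e1 e2 e3 e4 L) = r1 ->
  root2 h (eta1 e1 e2 e3 e4 L) (eta2 e1 e2 e3 e4 L) = r2 ->
  let c := Num.sqrt (2 * h) / pi in
  action_map e1 e2 e3 e4 h L =
  (c * wint e1 e2 e3 e4 1 e1 e2 r1 r2, c * wint e1 e2 e3 e4 (-1) e2 e3 r1 r2,
   c * wint e1 e2 e3 e4 1 e3 e4 r1 r2).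
Proof.
move=> e12 e23 e34 h0 D RE E1 E2 c; rewrite /action_map E1 E2.
have pE s : pfun e1 e2 e3 e4 h (eta1 e1 e2 e3 e4 L) (eta2 e1 e2 e3 e4 L) s =
    Num.sqrt (2 * h) / 2 * density e1 e2 e3 e4 r1 r2 s.
  rewrite /pfun RE /density.
  move: (Apol _ _ _ _ _) ((s - r1) * _) => A N.
  have -> : Num.sqrt (2 * h) / 2 = Num.sqrt (2 * h / 2 ^+ 2).
    by rewrite [RHS]sqrtrM ?mulr_ge0 ?(ltW h0)// sqrtrV// sqrtr_sqr ger0_norm.
  rewrite -sqrtrM ?divr_ge0 ?mulr_ge0 ?(ltW h0)//; congr Num.sqrt.
  have -> : (4 : R) = 2 ^+ 2 by ring.
  by rewrite invfM; ring.
have id1 := density_integral1 e12 e23 e34 D.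
have id2 := density_integral2 e12 e23 e34 D.
have id3 := density_integral3 e12 e23 e34 D.
have [fr1 fr2 fr3] := free_of_nodes_itvs e12 e23 e34.
have actE a b x y sg : free_of_nodes e1 e2 e3 e4 x y -> sg ^+ 2 = 1 ->
    (forall s, x <= s <= y -> sg * Apol e1 e2 e3 e4 s <= 0) -> x <= a -> b <= y ->
    act (pfun e1 e2 e3 e4 h (eta1 e1 e2 e3 e4 L) (eta2 e1 e2 e3 e4 L)) a b =
    c * (\int[mu]_(s in `[a, b]) density e1 e2 e3 e4 r1 r2 s)%R.
  move=> fr sg2 sA xa yb.
  have idn := integrable_density r1 r2 e12 e23 e34 fr sg2 sA xa yb.
  rewrite /act (_ : pfun _ _ _ _ _ _ _ =
    fun s => Num.sqrt (2 * h) / 2 * density e1 e2 e3 e4 r1 r2 s); last exact/funext.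
  have pi0 : (pi : R) != 0 by rewrite gt_eqF// pi_gt0.
  by rewrite RintegralZl// /c; move: pi pi0 => p p0; field.
have s1 : (1 : R) ^+ 2 = 1 by rewrite expr1n.
have sm1 : (-1 : R) ^+ 2 = 1 by rewrite sqrrN expr1n.
have A1 s := let: And3 p _ _ := @Apol_sign _ e1 e2 e3 e4 s e12 e23 e34 in p.
have A2 s := let: And3 _ p _ := @Apol_sign _ e1 e2 e3 e4 s e12 e23 e34 in p.
have A3 s := let: And3 _ _ p := @Apol_sign _ e1 e2 e3 e4 s e12 e23 e34 in p.
rewrite (actE _ _ _ _ _ fr1 s1 A1) ?ge_min ?lexx ?orbT// id1.
rewrite (actE _ _ _ _ _ fr2 sm1 A2) ?ge_min ?le_max ?lexx ?orbT// id2.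
by rewrite (actE _ _ _ _ _ fr3 s1 A3) ?le_max ?lexx ?orbT// id3.
Qed.

End surjectivity.

Theorem theorem6 (R : realType) (e1 e2 e3 e4 h : R) :
  e1 < e2 -> e2 < e3 -> e3 < e4 -> 0 < h ->
  action_map e1 e2 e3 e4 h @` M_h h = triangle h.
Proof.
move=> e12 e23 e34 h0; have p0 := pi_gt0 R.
have q0 : 0 < Num.sqrt (2 * h) by rewrite sqrtr_gt0; lra.
have c0 : 0 < Num.sqrt (2 * h) / pi by rewrite divr_gt0.
apply/seteqP; split=> [_ [L hL <-]|[[j1 j2] j3]].
  have [D0 Drt] := M_h_root_domain e12 e23 e34 h0 hL.
  rewrite (@action_map_wint _ e1 e2 e3 e4 h _ _ L e12 e23 e34 h0 Drt)//; last first.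
    by move=> z; exact: Rpol_factor.
  rewrite /triangle /=; do 3 (split; first by rewrite mulr_ge0 ?wint_ge0// ltW).
  by rewrite -!mulrDr sum_wint// divfK// gt_eqF.
move=> [/= j10 [j20 [j30 jsum]]].
pose c := Num.sqrt (2 * h) / pi; rewrite -/c in c0.
have cpi : c * pi = Num.sqrt (2 * h) by rewrite /c divfK// gt_eqF.
have kpi : j1 / c + j3 / c <= pi.
  by rewrite -mulrDl ler_pdivrMr// mulrC cpi -jsum; lra.
have [r1 [r2 [Drt K1 K3]]] := wint_surjective e12 e23 e34
  (divr_ge0 j10 (ltW c0)) (divr_ge0 j30 (ltW c0)) kpi.
have [L [hL E1 E2]] := exists_so4_of_roots e12 e23 e34 h0 Drt.
have r12 : r1 <= r2 by case: Drt.
(* The discriminant is a perfect square, so the quadratic formula returns the prescribed roots in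
   order. *)
have sE : Num.sqrt (eta1 e1 e2 e3 e4 L ^+ 2 - 8 * h * eta2 e1 e2 e3 e4 L) =
    2 * h * (r2 - r1).
  rewrite E1 E2 (_ : _ - _ = (2 * h * (r2 - r1)) ^+ 2); last by ring.
  by rewrite sqrtr_sqr ger0_norm// !mulr_ge0 ?subr_ge0// ltW.
exists L => //; rewrite (@action_map_wint _ e1 e2 e3 e4 h r1 r2 L e12 e23 e34 h0 Drt).
- rewrite -/c K1 K3 [c * (j1 / c)]mulrC [c * (j3 / c)]mulrC !divfK ?gt_eqF//.
  (* Only the outer coordinates were prescribed; the middle one is forced by the constant sum. *)
  congr (_, _, _); have := sum_wint e12 e23 e34 Drt; rewrite K1 K3 => Ks.
  have -> : wint e1 e2 e3 e4 (-1) e2 e3 r1 r2 = pi - j1 / c - j3 / c by lra.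
  rewrite !mulrBr cpi -jsum ![c * (_ / c)]mulrC !divfK ?gt_eqF//; ring.
- by move=> z; rewrite /Rpol E1 E2; ring.
- by rewrite /Defs.root1 sE E1; field; rewrite gt_eqF.
- by rewrite /root2 sE E1; field; rewrite gt_eqF.
Qed.
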